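(* Let $\mathcal{G}$ be an $N$-player game with action spaces $\mathcal{A}^1,\dots,\mathcal{A}^N$ and payoffs $u^1,\dots,u^N$, let $\varepsilon\ge 0$, and for each agent $i$ let $p^{-i}\mapsto \mathcal{S}^i_\varepsilon(p^{-i})$ be an ambiguity-set map from $\prod_{j\neq i}\mathcal{P}(\mathcal{A}^j)$ to subsets of $\mathcal{P}(\mathcal{A}^{-i})$. Suppose that either (A) every action space $\mathcal{A}^i$ is finite, or (B) every $\mathcal{A}^i$ is a compact subset of $\mathbb{R}^n$ and every payoff $u^i$ is continuous. Suppose moreover that each map $p^{-i}\mapsto \mathcal{S}^i_\varepsilon(p^{-i})$ is non-empty, compact-valued, and hemicontinuous (both upper and lower hemicontinuous). Then a strategically robust equilibrium of $\mathcal{G}$ with robustness level $\varepsilon$ exists.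
   Context: An $N$-player game consists of, for each $i\in\{1,\dots,N\}$, an action space $\mathcal{A}^i$ and a payoff $u^i:\mathcal{A}^1\times\cdots\times\mathcal{A}^N\to\mathbb{R}$, written $u^i(a^i,a^{-i})$ with $a^{-i}\in\mathcal{A}^{-i}:=\prod_{j\neq i}\mathcal{A}^j$. For a space $X$, $\mathcal{P}(X)$ is the set of Borel probability measures on $X$, with the topology of narrow convergence ($\mu_n\to\mu$ iff $\int\phi\,d\mu_n\to\int\phi\,d\mu$ for every bounded continuous $\phi$); finite sets carry the discrete topology. Compactness and hemicontinuity of the ambiguity-set maps are with respect to the product of the narrow topologies on $\mathcal{P}(\mathcal{A}^j)$, $j\ne i$ (domain), and the narrow topology on $\mathcal{P}(\mathcal{A}^{-i})$ (codomain). A mixed strategy of agent $i$ is $p^i\in\mathcal{P}(\mathcal{A}^i)$, and $p^{-i}=(p^j)_{j\ne i}$. For $p^i\in\mathcal{P}(\mathcal{A}^i)$ and $q\in\mathcal{P}(\mathcal{A}^{-i})$ (possibly non-product), $U^i(p^i,q):=\mathbb{E}_{a^i\sim p^i,\,a^{-i}\sim q}[u^i(a^i,a^{-i})]$, with $a^i$ and $a^{-i}$ drawn independently. A profile $(\bar p^1,\dots,\bar p^N)$ is a strategically robust equilibrium with robustness level $\varepsilon$ if for every $i$, $\bar p^i\in\arg\max_{p^i\in\mathcal{P}(\mathcal{A}^i)}\min_{q\in\mathcal{S}^i_\varepsilon(\bar p^{-i})}U^i(p^i,q)$. *)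

(* Defs.v *)
From HB Require Import structures.
From mathcomp Require Import all_boot all_order all_algebra.
From mathcomp Require Import all_classical all_reals all_analysis.

Unset Implicit Arguments.
Unset Printing Implicit Defensive.

Import Order.TTheory GRing.Theory Num.Theory numFieldNormedType.Exports.

Local Open Scope classical_set_scope.
Local Open Scope ring_scope.

(* The product-topology space of (opponent) action profiles is pointed
   (needed to equip it with its Borel sigma-algebra). *)
HB.instance Definition _ (I : Type) (X : ptopologicalType) :=
  Pointed.copy {ptws I -> X} (I -> X).

Section SRE.
Variable R : realType.

Definition borel (X : ptopologicalType) := g_sigma_algebraType (@open X).

Definition PM (X : ptopologicalType) := probability (borel X) R.
HB.instance Definition _ (X : ptopologicalType) := gen_eqMixin (PM X).
HB.instance Definition _ (X : ptopologicalType) := gen_choiceMixin (PM X).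

(** [P(A)] for A a subset of the ambient space X: the Borel probability
    measures on X that are carried by A (i.e. give full mass to A). *)
Definition PMon {X : ptopologicalType} (A : set X) : set (PM X) :=
  [set mu | mu A = 1%E].

(** Bounded continuous functions on A (w.r.t. the subspace topology of A);
    values outside A are irrelevant. *)
Definition bounded_continuous_on {X : ptopologicalType} (A : set X)
    (phi : X -> R) :=
  (exists M : R, forall x, A x -> `|phi x| <= M) /\ {within A, continuous phi}.

Definition BC {X : ptopologicalType} (A : set X) :=
  {phi : X -> R | bounded_continuous_on A phi}.

Definition narrow_map {X : ptopologicalType} (A : set X) (mu : PM X)
  : {ptws BC A -> R} := fun phi => Rintegral mu A (sval phi).

Definition narrow {X : ptopologicalType} (A : set X) : topologicalType :=
  initial_topology (@narrow_map X A).

Definition upper_hemicontinuous {T U : topologicalType} (D : set T)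
    (F : T -> set U) :=
  forall x, D x -> forall V : set U, open V -> F x `<=` V ->
    exists W : set T, [/\ open W, W x &
      forall y, D y -> W y -> F y `<=` V].

Definition lower_hemicontinuous {T U : topologicalType} (D : set T)
    (F : T -> set U) :=
  forall x, D x -> forall V : set U, open V -> F x `&` V !=set0 ->
    exists W : set T, [/\ open W, W x &
      forall y, D y -> W y -> F y `&` V !=set0].

Variables (N : nat) (X : ptopologicalType) (A : 'I_N -> set X).

Definition opp (i : 'I_N) := {j : 'I_N | j != i}.
Definition Xopp (i : 'I_N) := {ptws opp i -> X}.
Definition Aopp (i : 'I_N) : set (Xopp i) := [set b | forall j, A (val j) (b j)].

Definition join (i : 'I_N) (a : X) (b : opp i -> X) : 'I_N -> X :=
  fun j => oapp b a (insub j).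

Definition Aprof : set ({ptws 'I_N -> X}) := [set a | forall j, A j (a j)].

Definition Dom (i : 'I_N) : topologicalType :=
  prod_topology (fun j : opp i => narrow (A (val j))).
Definition DomSet (i : 'I_N) : set (Dom i) :=
  [set p | forall j, PMon (A (val j)) (p j)].

Definition Cod (i : 'I_N) : topologicalType := narrow (Aopp i).

Definition ambiguity_map (i : 'I_N) := (opp i -> PM X) -> set (PM (Xopp i)).

Definition U (i : 'I_N) (ui : ('I_N -> X) -> R) (p : PM X) (q : PM (Xopp i))
  : \bar R :=
  (\int[p \x q]_(z in A i `*` Aopp i) (ui (join i z.1 z.2))%:E)%E.

Definition robust_value (i : 'I_N) (ui : ('I_N -> X) -> R)
    (Q : set (PM (Xopp i))) (p : PM X) : \bar R :=
  ereal_inf [set U i ui p q | q in Q].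

Definition minus (i : 'I_N) (p : 'I_N -> PM X) : opp i -> PM X :=
  fun j => p (val j).

Definition admissible_ambiguity (i : 'I_N) (Si : ambiguity_map i) :=
  [/\ forall p, DomSet i p -> Si p `<=` PMon (Aopp i),
      forall p, DomSet i p -> Si p !=set0,
      forall p, DomSet i p -> @compact (Cod i) (Si p),
      @upper_hemicontinuous (Dom i) (Cod i) (DomSet i) Si &
      @lower_hemicontinuous (Dom i) (Cod i) (DomSet i) Si].

Definition strategically_robust_equilibrium
    (u : 'I_N -> ('I_N -> X) -> R) (S : forall i, ambiguity_map i)
    (pbar : 'I_N -> PM X) :=
  (forall i, PMon (A i) (pbar i)) /\
  forall i (p : PM X), PMon (A i) p ->
    (robust_value i (u i) (S i (minus i pbar)) p
      <= robust_value i (u i) (S i (minus i pbar)) (pbar i))%E.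

End SRE.

(* Main.v *)
(** Writing V_i(p, x) for the worst-case payoff of agent i playing p against the
    profile x, both hemicontinuities make V_i jointly continuous (Berge), and it
    is concave in p.  With phi(x, y) = sum_i (V_i(y_i, x) - V_i(x_i, x)), a
    robust equilibrium is a profile x such that phi(x, y) <= 0 for all y (Ky Fan).
    For finitely many deviations y_k, such an x exists among the convex
    combinations of the y_k by a Brouwer-type lemma on the simplex, obtained here
    from Scarf's combinatorial lemma; compactness of the space of profiles then
    handles all deviations at once.  That space is compact because an
    ultrafilter of probability measures has a limit functional on continuous
    functions, which the Riesz theorem represents by a measure. *)

(* Best replies need not be unique, and strategies form an infinite-dimensional space given without
   linear structure. So no fixed point of the best-reply map is sought: all fixed-point content sits
   in finite systems of inequalities on a simplex of weights. Concavity of V_i, an infimum of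
   functions affine in p, is what makes the weighted sum of these inequalities nonpositive. The
   narrow topologies control integrals over one factor only, whereas a payoff integrates u_i against
   the product of p and q. The bridge is uniform approximation of u_i by finite sums of f_j(a)
   h_j(b). It yields measurability for the product sigma-algebra, affineness in p, and the
   continuity behind Berge's argument. Finite and compact Euclidean action spaces share one
   property: the trace on A of any open set is the positivity set of a continuous function. This
   lets open sets be tested by continuous functions in the Riesz theorem, and it supplies partitions
   of unity. *)
Require Import Defs.
From HB Require Import structures.
From mathcomp Require Import all_boot.

(** * Scarf's combinatorial lemma *)

Section Scarf.
Variables (I T : finType) (r : I -> T -> nat).
Hypothesis r_inj : forall i, injective (r i).

(** No [t] exceeds, in all orders of [C] at once, the minimum of [s]. Read [(s, C)] as the simplex
    whose vertices are the points of [s] and the indices outside [C]; dominance then passes to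
    faces. *)
Definition dominant (s : {set T}) (C : {set I}) :=
  [forall t, exists i in C, forall x in s, r i t <= r i x].

Lemma dominantP (s : {set T}) (C : {set I}) :
  reflect (forall t, exists2 i, i \in C & forall x, x \in s -> r i t <= r i x)
          (dominant s C).
Proof.
apply: (iffP forallP) => H t.
  by have /exists_inP[i iC /forall_inP ti] := H t; exists i.
by have [i iC ti] := H t; apply/exists_inP; exists i => //; apply/forall_inP.
Qed.

(** In that reading a cell has [#|I|] vertices, and a door, its facet, has one fewer. *)
Definition cell (p : {set T} * {set I}) :=
  dominant p.1 p.2 && (#|p.1| == #|p.2|).

Definition door (p : {set T} * {set I}) :=
  dominant p.1 p.2 && (#|p.2| == #|p.1|.+1).

Definition incident (p d : {set T} * {set I}) :=
  (d.1 \subset p.1) && (p.2 \subset d.2).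

Lemma dominantS {s t : {set T}} {C D : {set I}} :
  t \subset s -> C \subset D -> dominant s C -> dominant t D.
Proof.
move=> /fintype.subsetP ts /fintype.subsetP CD /dominantP H; apply/dominantP => x.
by have [i iC xi] := H x; exists i; [exact: CD|move=> y /ts; exact: xi].
Qed.

(** The one vertex that a cell has beyond its facet is either an index or a point. *)
Lemma incidentP (p d : {set T} * {set I}) :
  #|p.1| == #|p.2| -> #|d.2| == #|d.1|.+1 -> incident p d ->
  (exists2 k, k \in d.2 & p = (d.1, d.2 :\ k)) \/
  (exists2 t, t \notin d.1 & p = (t |: d.1, d.2)).
Proof.
case: p d => s C [t D] /= /eqP sC /eqP Dt /andP[/= ts CD].
have := subset_leq_card ts; rewrite leq_eqVlt => /orP[/eqP tss|tss].
  have {ts}st : t = s by apply/eqP; rewrite eqEcard ts tss leqnn.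
  have : C \proper D by rewrite properEcard CD Dt st sC leqnn.
  move=> /properP[_ [k kD kC]]; left; exists k => //; congr pair => //.
  apply/eqP; rewrite eqEcard; apply/andP; split.
    by rewrite subsetD1 CD kC.
  have := cardsD1 k D; rewrite kD Dt st sC add1n => -[->]; exact: leqnn.
have {CD}DC : D = C.
  by apply/eqP; rewrite eq_sym eqEcard CD Dt -sC tss.
have : t \proper s by rewrite properEcard ts tss.
move=> /properP[_ [x xs xt]]; right; exists x => //; congr pair => //.
apply/eqP; rewrite eq_sym eqEcard; apply/andP; split.
  by rewrite subUset sub1set xs ts.
by rewrite cardsU1 xt add1n sC -Dt DC.
Qed.

(** Dominance tested at a point of [s] itself makes it the minimum for some index of [C]. Taking
    minima thus maps indices onto points: bijectively for a cell, with a single coincidence for a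
    door. *)
Lemma dominant_argmin {s : {set T}} {C : {set I}} : dominant s C -> s != set0 ->
  exists m : I -> T, [/\ forall i, m i \in s,
    forall i x, x \in s -> r i (m i) <= r i x & m @: C = s].
Proof.
move=> /dominantP dsC /set0Pn[x0 x0s].
pose m i := [arg min_(x < x0 in s) r i x].
have mP i : m i \in s /\ forall x, x \in s -> r i (m i) <= r i x.
  by rewrite /m; case: arg_minnP.
exists m; split=> [i|i|]; [by have [] := mP i|by have [] := mP i|].
apply/setP => x; apply/imsetP/idP => [[i _ ->]|xs]; first by have [] := mP i.
have [i iC xi] := dsC x; exists i => //; apply: (r_inj i).
have [ms mmin] := mP i.
by apply/eqP; rewrite eqn_leq xi// mmin.
Qed.

(** * Pivoting: the two cells at a door *)

Section door_cells.
Variables (t : {set T}) (D : {set I}).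
Hypotheses (t0 : t != set0) (tD : dominant t D) (Dt : #|D| == #|t|.+1).

(** The minima over [D :\ k] still reach all of [t]; this singles out the two indices of the door
    that share their minimum. *)
Let surj k := forall x, x \in t ->
  exists2 l, l \in D :\ k & forall y, y \in t -> r l x <= r l y.

(** The points that violate dominance of [(t, D :\ k)]. *)
Let M k := [set x | [forall l in D :\ k, exists y in t, r l y < r l x]].

Let MP k x : reflect (forall l, l \in D -> l != k ->
   exists2 y, y \in t & r l y < r l x) (x \in M k).
Proof.
rewrite inE; apply: (iffP forall_inP) => H l.
  by move=> lD lk; apply/exists_inP/H; rewrite !inE lk.
by rewrite !inE => /andP[lk lD]; apply/exists_inP/H.
Qed.

(** The pivot step: drop [k] if nothing violates dominance; otherwise add the [r k]-largest
    violating point, so that the order [k] takes care of all the other ones. *)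
Let cellof k := if [pick x in M k | [forall y in M k, r k y <= r k x]] is Some x
  then (x |: t, D) else (t, D :\ k).

Let M0 k : (fun x => (x \in M k) && [forall y in M k, r k y <= r k x]) =1 pred0 ->
  M k = set0.
Proof.
move=> H; apply/eqP/negPn/negP => /set0Pn[x xM].
have := H [arg max_(y > x in M k) r k y].
case: arg_maxnP => // y yM ymax /andP[]; split => //.
by apply/forall_inP => z; exact: ymax.
Qed.

Let cellof_cell k : k \in D -> surj k -> cell (cellof k) && incident (cellof k) (t, D).
Proof.
move=> kD sk; rewrite /cellof; case: pickP => [x|/M0 M0k].
- move=> /andP[xM /forall_inP xmax].
  rewrite /cell /incident /= subxx subsetUr !andbT; apply/andP; split.
    apply/dominantP => y.
    have [yM|] := boolP (y \in M k).
      exists k => // z; rewrite inE => /orP[/set1P->|zt]; first exact: xmax.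
      have /dominantP/(_ y)[l lD yl] := tD.
      have [<-|lk] := eqVneq l k; first exact: yl.
      have /MP/(_ l lD lk)[w wt] := yM.
      by rewrite ltnNge yl.
    rewrite inE negb_forall => /existsP[l].
    rewrite negb_imply => /andP[]; rewrite !inE => /andP[lk lD] /exists_inPn yl.
    have {}yl z : z \in t -> r l y <= r l z by move=> /yl; rewrite -leqNgt.
    exists l => // z; rewrite inE => /orP[/set1P->|/yl//].
    have /MP/(_ l lD lk)[w wt /ltnW wx] := xM.
    exact: leq_trans (yl _ wt) wx.
  have xt : x \notin t.
    apply/negP => /sk[l]; rewrite !inE => /andP[lk lD] xl.
    have /MP/(_ l lD lk)[w wt] := xM.
    by rewrite ltnNge xl.
  by rewrite cardsU1 xt add1n eq_sym.
- rewrite /cell /incident /= subxx subsetDl !andbT; apply/andP; split.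
    apply/dominantP => y.
    have : y \notin M k by rewrite M0k inE.
    rewrite inE negb_forall => /existsP[l].
    rewrite negb_imply => /andP[lDk /exists_inPn yl].
    by exists l => // z /yl; rewrite -leqNgt.
  by rewrite eq_sym -eqSS -(eqP Dt) (cardsD1 k D) kD add1n.
Qed.

(** Here [k] is the dropped index, or the index whose minimum is the added point; dominance of the
    cell forces that point to be the largest violating one. *)
Let cell_of p : cell p -> incident p (t, D) ->
  exists k, [/\ k \in D, surj k & p = cellof k].
Proof.
move=> /andP[dp cp] /(incidentP _ (t, D) cp Dt)[[k /= kD pE]|[x /= xt pE]].
  exists k; split => //; move: dp; rewrite {}pE /= => /dominantP dp.
    by move=> x xt; have [l] := dp x; exists l.
  rewrite /cellof; case: pickP => // x /andP[/MP xM _].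
  have [l] := dp x; rewrite !inE => /andP[lk lD] xl.
  have [y yt] := xM l lD lk; by rewrite ltnNge xl.
move: dp cp; rewrite {}pE /= => dp; rewrite cardsU1 xt add1n => cp.
have xt0 : x |: t != set0 by apply/set0Pn; exists x; rewrite setU11.
have [m [ms mm mD]] := dominant_argmin dp xt0.
have m_inj : {in D &, injective m}.
  by apply/imset_injP; rewrite mD cardsU1 xt add1n.
have : x \in m @: D by rewrite mD setU11.
case/imsetP => k kD xk.
have xM : x \in M k.
  apply/MP => l lD lk.
  have : m l \in x |: t by exact: ms.
  rewrite inE => /orP[/set1P mlx|mlt].
    by move: lk; rewrite (m_inj l k) ?eqxx// mlx.
  exists (m l) => //; rewrite ltn_neqAle mm ?setU11// andbT.
  by apply/eqP => /r_inj mlx; rewrite mlx (negbTE xt) in mlt.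
have sk : surj k.
  move=> y yt; have : y \in m @: D by rewrite mD setU1r.
  case/imsetP => l lD yl; exists l; last first.
    by move=> z zt; rewrite yl mm// setU1r.
  rewrite !inE lD andbT; apply/eqP => lk; move: yt.
  by rewrite yl lk -xk (negbTE xt).
have xmax y : y \in M k -> r k y <= r k x.
  move=> /MP yM; have /dominantP/(_ y)[l lD yl] := dp.
  have [<-|lk] := eqVneq l k; first by rewrite yl// setU11.
  have [z zt] := yM l lD lk.
  by rewrite ltnNge yl// setU1r.
exists k; split=> //; rewrite /cellof; case: pickP => [y /andP[yM]|/(_ x)].
  move=> /forall_inP ymax; congr ((_ |: _), _); apply: (r_inj k).
  by apply/eqP; rewrite eqn_leq ymax// xmax.
by move=> /negP[]; rewrite xM; apply/forall_inP.
Qed.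

(** With one index more than points, exactly two indices [i] and [j] share their minimum, and
    pivoting at each of them gives one cell. *)
Lemma door_two_cells : #|[set p | cell p && incident p (t, D)]| = 2.
Proof.
have [m [ms mm mD]] := dominant_argmin tD t0.
have : ~~ dinjectiveb m D.
  apply/negP => /dinjectiveP/imset_injP.
  by rewrite mD (eqP Dt) eqn_leq ltnn andbF.
move=> /dinjectivePn[i iD [j]]; rewrite !inE => /andP[ji jD] mij.
have surjE k l : l \in D -> l != k -> m k = m l -> surj k.
  move=> lD lk mkl x; rewrite -{1}mD => /imsetP[h hD xh].
  have [hk|hk] := eqVneq h k.
    by exists l; [rewrite !inE lk|move=> y yt; rewrite xh hk mkl mm].
  by exists h; [rewrite !inE hk|move=> y yt; rewrite xh mm].
have si : surj i by apply: (surjE i j).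
have sj : surj j by apply: (surjE j i) => //; rewrite eq_sym.
have inj k l : k \in D -> l \in D -> l != k -> m k = m l ->
    {in D :\ k &, injective m}.
  move=> kD lD lk mkl; apply/imset_injP.
  have -> : m @: (D :\ k) = t.
    rewrite -mD; apply/setP => x; apply/imsetP/imsetP => -[h].
      by rewrite !inE => /andP[hk hD] ->; exists h.
    move=> hD ->; have [->|hk] := eqVneq h k.
      by exists l => //; rewrite !inE lk.
    by exists h => //; rewrite !inE hk.
  by rewrite -eqSS -(eqP Dt) (cardsD1 k D) kD add1n.
have uniq_ij k : k \in D -> surj k -> k = i \/ k = j.
  move=> kD /(_ (m k) (ms k))[l]; rewrite !inE => /andP[lk lD] mkl.
  have {}mkl : m k = m l.
    by apply: (r_inj l); apply/eqP; rewrite eqn_leq mkl// mm.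
  have [->|ki] := eqVneq k i; [by left|right].
  have [li|li] := eqVneq l i.
    apply/eqP/negPn/negP => kj; move/eqP: lk; apply.
    apply: (inj j i) => //; rewrite ?inE ?lD ?kD ?kj ?li 1?eq_sym//.
    by rewrite ji.
  move/eqP: lk; case; apply: (inj i j) => //; by rewrite !inE ?li ?ki.
have -> : [set p | cell p && incident p (t, D)] = [set cellof i; cellof j].
  apply/setP => p; rewrite !inE; apply/andP/orP.
    move=> [/cell_of H /H[k [kD sk ->]]].
    by have [->|->] := uniq_ij k kD sk; rewrite eqxx; [left|right].
  by case=> /eqP ->; apply/andP/cellof_cell.
rewrite cards2; case: eqP => //; rewrite /cellof.
have Mt k x : surj k -> x \in M k -> x \notin t.
  move=> sk xM; apply/negP => /sk[l]; rewrite !inE => /andP[lk lD] xl.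
  have /MP/(_ l lD lk)[w wt] := xM; by rewrite ltnNge xl.
case: pickP => [x /andP[xM _]|_]; case: pickP => [y /andP[yM _]|_] [].
(* The same point added for both indices would exceed the minimum of [t] in every order of [D],
   against dominance of the door. *)
- have xt := Mt _ _ si xM; have yt := Mt _ _ sj yM.
  move=> xy; have {xy} : x \in y |: t by rewrite -xy setU11.
  rewrite !inE (negbTE xt) orbF => /eqP xy.
  have /dominantP/(_ x)[l lD xl] := tD.
  have [li|li] := eqVneq l i.
    have /MP/(_ l lD) := yM; rewrite -xy li eq_sym ji => /(_ erefl)[w wt].
    by rewrite ltnNge -li xl.
  have /MP/(_ l lD li)[w wt] := xM; by rewrite ltnNge xl.
- by move=> /setP/(_ x); rewrite setU11 (negbTE (Mt _ _ si xM)).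
- by move=> /setP/(_ y); rewrite setU11 (negbTE (Mt _ _ sj yM)).
- by move=> /setP/(_ i); rewrite !inE eqxx iD eq_sym ji.
Qed.

End door_cells.

Variables (c : T -> I) (i0 : I).

(** Colour each index outside [D] by itself: a coloured door then carries every colour except [i0]
    exactly once, as in the parity proof of Sperner's lemma. *)
Definition coloured (d : {set T} * {set I}) :=
  (i0 \in d.2) && (c @: d.1 == d.2 :\ i0).

(** The only boundary facet: dropping [i0] would leave no order at all, so the one cell comes from
    adding the [r i0]-largest point. *)
Lemma empty_door_cell (x0 : T) :
  #|[set p | cell p && incident p (set0, [set i0])]| = 1.
Proof.
pose x := [arg max_(y > x0) r i0 y].
have xmax y : r i0 y <= r i0 x by rewrite /x; case: arg_maxnP => // z _; exact.
rewrite (_ : [set _ | _] = [set ([set x], [set i0])]) ?cards1//.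
apply/setP => p; rewrite !inE; apply/idP/eqP => [/andP[pc pinc]|->].
  case/andP: pc => dp cp; case: (incidentP _ _ cp _ pinc) => /=.
  - by rewrite cards1 cards0.
  - case=> k /set1P -> pE; move: dp; rewrite pE /= => /dominantP/(_ x0)[i].
    by rewrite !inE andNb.
  - case=> t _ pE; rewrite setU0 in pE.
    suff -> : x = t by [].
    apply: (r_inj i0); apply/eqP; rewrite eqn_leq xmax andbT.
    move: dp; rewrite pE /= => /dominantP/(_ x)[i /set1P ->]; apply.
    by rewrite inE.
rewrite /cell /incident /= !cards1 eqxx sub0set subxx !andbT.
by apply/dominantP => y; exists i0; rewrite ?inE// => z /set1P ->.
Qed.

(** If there is a coloured door, exactly two vertices of the cell share a colour, and the coloured
    doors are obtained by removing one or the other: their number is 0 or 2. *)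
Lemma cell_even_doors p : cell p -> c @: p.1 != p.2 ->
  ~~ odd #|[set d | [&& door d, coloured d & incident p d]]|.
Proof.
case: p => s C /= /andP[/= dsC /eqP sC] nfull.
have [->|] := eqVneq [set d | [&& door d, coloured d & incident (s, C) d]] set0.
  by rewrite cards0.
set E := [set d | _] => /set0Pn[e eE].
have E1 x : x \in s -> c @: (s :\ x) = C :\ i0 -> i0 \in C -> (s :\ x, C) \in E.
  move=> xs sxC i0C; rewrite inE /door /coloured /incident /= i0C sxC eqxx subxx.
  rewrite subsetDl (dominantS (subsetDl _ _) (subxx C) dsC) /= andbT.
  by rewrite -sC (cardsD1 x s) xs add1n.
have E2 i : i \notin C -> i0 \in C -> c @: s = (i |: C) :\ i0 -> (s, i |: C) \in E.
  move=> iC i0C csC; rewrite inE /door /coloured /incident /= csC eqxx subxx.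
  rewrite subsetUr (dominantS (subxx s) (subsetUr _ _) dsC) /= !inE i0C orbT !andbT.
  by rewrite cardsU1 iC add1n sC.
have EP d : d \in E -> i0 \in C /\
   ((exists x, [/\ x \in s, c @: (s :\ x) = C :\ i0 & d = (s :\ x, C)]) \/
   (exists i, [/\ i \notin C, c @: s = (i |: C) :\ i0 & d = (s, i |: C)])).
  rewrite inE; case: d => t D /and3P[/andP[_ Dt] /andP[/= i0D /eqP ctD] inc].
  have sCE : #|(s, C).1| == #|(s, C).2| by rewrite /= sC.
  case: (incidentP _ _ sCE Dt inc) => /= -[k kD] [st CD].
    have kC : k \notin C by rewrite CD !inE eqxx.
    have i0C : i0 \in C.
      rewrite CD !inE i0D andbT; apply/eqP => i0k.
      by move: nfull; rewrite st ctD i0k CD eqxx.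
    split => //; right; exists k; split => //.
      by rewrite st ctD CD setD1K.
    by rewrite st CD setD1K.
  split; rewrite ?CD//; left; exists k; have tE : s :\ k = t.
    by rewrite st setU1K.
  by split; rewrite ?tE//; rewrite st setU11.
have cardsD1s x : x \in s -> #|s :\ x| = #|s|.-1.
  by move=> xs; rewrite (cardsD1 x s) xs.
have cinj x : i0 \in C -> x \in s -> c @: (s :\ x) = C :\ i0 ->
    {in s :\ x &, injective c}.
  move=> i0C xs cx; apply/imset_injP.
  by rewrite cx cardsD1s// sC (cardsD1 i0 C) i0C.
have [i0C _] := EP e eE.
have neqi0 x : x \in s -> c @: (s :\ x) = C :\ i0 -> c x != i0.
  move=> xs cx; apply/eqP => cxi0; move/eqP: nfull; apply.
  by rewrite -(setD1K xs) imsetU1 cx cxi0 setD1K.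
(* The second vertex with the colour [c x] is another point of [s] if [c x] lies in [C], and the
   index [c x] itself otherwise. *)
have sub_two x : x \in s -> c @: (s :\ x) = C :\ i0 -> exists d1 d2,
   d1 != d2 /\ E = [set d1; d2].
  move=> xs cx; have [cxC|cxC] := boolP (c x \in C).
    have : c x \in c @: (s :\ x) by rewrite cx !inE neqi0.
    case/imsetP => y; rewrite !inE => /andP[yx ys] cxy.
    have cy : c @: (s :\ y) = C :\ i0.
      rewrite -cx; apply/setP => j; apply/imsetP/imsetP => -[z].
        rewrite !inE => /andP[zy zs] ->; have [->|zx] := eqVneq z x.
          by exists y => //; rewrite !inE yx.
        by exists z => //; rewrite !inE zx.
      rewrite !inE => /andP[zx zs] ->; have [->|zy] := eqVneq z y.
        by exists x => //; rewrite !inE eq_sym yx.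
      by exists z => //; rewrite !inE zy.
    exists (s :\ x, C), (s :\ y, C); split.
      by apply/eqP => -[] /setP/(_ x); rewrite !inE eqxx xs eq_sym yx.
    apply/setP => d; rewrite !inE -/E; apply/idP/orP; last first.
      by case=> /eqP ->; have := E1 x xs cx i0C; have := E1 y ys cy i0C;
        rewrite !inE.
    move=> dE; have : d \in E by rewrite inE.
    move=> /EP[_ [[z [zs cz ->]]|[i [iC ci _]]]].
      have [->|zx] := eqVneq z x; first by left; rewrite eqxx.
      have [->|zy] := eqVneq z y; first by right; rewrite eqxx.
      have := cinj z i0C zs cz x y.
      rewrite !inE eq_sym zx xs eq_sym zy ys => /(_ erefl erefl cxy) xy.
      by rewrite xy eqxx in yx.
    have cinjs : {in s &, injective c}.
      apply/imset_injP; rewrite ci sC.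
      have := cardsD1 i0 (i |: C); rewrite inE i0C orbT cardsU1 iC !add1n.
      by move=> [->].
    by have := cinjs x y xs ys cxy => xy; rewrite xy eqxx in yx.
  have cs : c @: s = (c x |: C) :\ i0.
    rewrite -(setD1K xs) imsetU1 cx; apply/setP => j; rewrite !inE.
    by have [->|] := eqVneq j (c x); rewrite ?neqi0.
  exists (s :\ x, C), (s, c x |: C); split.
    by apply/eqP => -[] /setP/(_ x); rewrite !inE eqxx xs.
  apply/setP => d; rewrite !inE -/E; apply/idP/orP; last first.
    case=> /eqP ->.
      by have := E1 x xs cx i0C; rewrite !inE.
    by have := E2 _ cxC i0C cs; rewrite !inE.
  move=> dE; have : d \in E by rewrite inE.
  move=> /EP[_ [[z [zs cz ->]]|[i [iC ci ->]]]].
    have [->|zx] := eqVneq z x; first by left; rewrite eqxx.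
    have : c x \in c @: (s :\ z).
      by apply/imsetP; exists x; rewrite // !inE xs eq_sym zx.
    by rewrite cz !inE (negbTE cxC) andbF.
  right; have : c x \in c @: s by apply: imset_f.
  by rewrite ci !inE (negbTE cxC) orbF => /andP[_ /eqP ->].
suff [d1 [d2 [d12 ->]]] : exists d1 d2, d1 != d2 /\ E = [set d1; d2].
  by rewrite cards2 d12.
have [_ [[x [xs cx _]]|[i [iC ci _]]]] := EP e eE.
  exact: (sub_two x).
(* This door removes the index vertex [i]; its colour recurs on a point [x] of [s], and removing [x]
   instead leads back to [sub_two]. *)
have ii0 : i != i0 by apply: contraNneq iC => ->.
have : i \in c @: s by rewrite ci !inE eqxx ii0.
case/imsetP => x xs ix; apply: (sub_two x) => //.
have cinjs : {in s &, injective c}.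
  apply/imset_injP; rewrite ci sC.
  have := cardsD1 i0 (i |: C); rewrite inE i0C orbT cardsU1 iC !add1n.
  by move=> [->].
apply/setP => j; apply/imsetP/idP.
  case=> y; rewrite !inE => /andP[yx ys] ->.
  have : c y \in c @: s by exact: imset_f.
  rewrite ci !inE => /andP[-> /orP[/eqP|->//]].
  by rewrite ix => /cinjs yxE; rewrite yxE ?eqxx in yx.
rewrite !inE => /andP[ji0 jC].
have : j \in c @: s by rewrite ci !inE jC ji0 orbT.
case/imsetP => y ys jy; exists y; rewrite // !inE ys andbT.
by apply: contraNneq iC => yx; rewrite ix -yx -jy.
Qed.

(* Count modulo 2 the incidences between cells and coloured doors: a door lies in
   two cells, except the coloured door (set0, [set i0]) which lies in one, while a
   cell that is not fully coloured has an even number of coloured doors. *)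
Theorem scarf (x0 : T) : exists s C, [/\ dominant s C, s != set0 & c @: s = C].
Proof.
suff [p /andP[pc /eqP pE]] : exists p, cell p && (c @: p.1 == p.2).
  exists p.1, p.2; split => //; first by case/andP: pc.
  case/andP: pc => /dominantP/(_ x0)[i ip2 _] /eqP pp; rewrite -card_gt0 pp.
  by apply/card_gt0P; exists i.
apply/existsP; apply: contraT => /existsPn nofull.
pose n := \sum_(p | cell p) \sum_(d | [&& door d, coloured d & incident p d]) 1.
have n_even : ~~ odd n.
  rewrite /n (big_morph odd oddD (erefl (odd 0))) big1// => p pc.
  apply/negbTE; have := cell_even_doors p pc; rewrite -sum1dep_card; apply.
  by have := nofull p; rewrite pc.
have nE : n = \sum_(d | door d && coloured d) #|[set p | cell p && incident p d]|.
  rewrite /n (exchange_big_dep (fun d => door d && coloured d)) /=; last first.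
    by move=> p d _ /and3P[-> ->].
  apply: eq_bigr => d /andP[dd cd]; rewrite -sum1dep_card; apply: eq_bigl => p.
  by rewrite dd cd.
move: n_even; rewrite nE (bigD1 (set0, [set i0])) /=; last first.
  rewrite /door /coloured /= imset0 cards1 cards0 inE eqxx setDv !eqxx !andbT.
  by apply/dominantP => t; exists i0; rewrite ?inE// => y; rewrite inE.
rewrite empty_door_cell// oddD (big_morph odd oddD (erefl (odd 0))) big1//.
move=> [t D] /andP[/andP[/andP[/= tD Dt] /andP[/= i0D /eqP ctD]] ntD].
(* A coloured door without points has [D :\ i0] empty, so it is the boundary door already split
   off. *)
rewrite door_two_cells//; apply: contraNneq ntD => t0.
apply/eqP; congr pair => //; move: ctD; rewrite t0 imset0 => /esym/eqP.
rewrite setD_eq0 => Di0; apply/eqP; rewrite eqEsubset Di0 sub1set.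
exact: i0D.
Qed.

End Scarf.

(** * The Gale lemma on the simplex *)

From mathcomp Require Import all_order all_algebra.
From mathcomp Require Import all_classical all_reals all_analysis.
From mathcomp Require Import measurable_realfun zify ring lra.
Import Order.TTheory GRing.Theory Num.Theory numFieldNormedType.Exports.
Local Open Scope classical_set_scope.
Local Open Scope ring_scope.

(** * Scarf's lemma for the lattice points of a simplex *)

Section lattice.
Variables (m n : nat).
Let T : finType := {k : {ffun 'I_m.+1 -> 'I_n.+1} | (\sum_i k i == n)%N}.

Let mk (k : {ffun 'I_m.+1 -> 'I_n.+1}) (kn : (\sum_i k i == n)%N) : T := exist _ k kn.

(** The order by the [i]-th coordinate, with ties broken by the enumeration of [T] to make it
    injective. *)
Let rk (i : 'I_m.+1) (k : T) : nat := (val k i * #|T| + enum_rank k)%N.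

Let rk_inj i : injective (rk i).
Proof.
move=> k l /(congr1 (modn^~ #|T|)).
rewrite /rk !modnMDl !modn_small; try exact: ltn_ord.
by move/val_inj/enum_rank_inj.
Qed.

Let rk_lt i (k l : T) : (val k i < val l i)%N -> (rk i k < rk i l)%N.
Proof.
move=> kl; rewrite /rk; have := ltn_ord (enum_rank k).
move: (nat_of_ord (enum_rank k)) (nat_of_ord (enum_rank l)) => a b ak.
apply: (@leq_trans ((val k i).+1 * #|T|)%N); first by rewrite mulSn addnC ltn_add2r.
by rewrite (leq_trans _ (leq_addr _ _))// leq_mul2r kl orbT.
Qed.

(** The coordinate minima [M] of a dominant set, taken as 0 outside [C], have total at least
    [n - m]. As the coordinates of a point sum to [n], each exceeds its minimum by at most [m]:
    points of the set are [m]-close, and small in the coordinates outside [C]. *)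
Lemma lattice_scarf (c : T -> 'I_m.+1) : exists (s0 : T) (s : 'I_m.+1 -> option T),
  forall i, match s i with
  | Some k => c k = i /\ (forall j, val k j <= val s0 j + m /\
                                    val s0 j <= val k j + m)%N
  | None => (val s0 i <= m)%N end.
Proof.
have k0P : (\sum_(i < m.+1)
    [ffun i : 'I_m.+1 => if i == ord0 then @ord_max n else ord0] i == n)%N.
  rewrite (bigD1 ord0)//= ffunE eqxx big1 ?addn0// => i /negbTE i0.
  by rewrite ffunE i0.
have [s [C [sC sn0 cs]]] := scarf _ _ rk rk_inj c ord0 (mk _ k0P).
have [f [fs fmin _]] := dominant_argmin _ _ _ rk_inj sC sn0.
have fle i x : x \in s -> (val (f i) i <= val x i)%N.
  move=> xs; rewrite leqNgt; apply/negP => /rk_lt.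
  by rewrite ltnNge fmin.
have [i1 i1C] : exists i, i \in C.
  have [i iC _] := dominantP _ _ _ _ _ sC (mk _ k0P); by exists i.
pose M i := if i \in C then nat_of_ord (val (f i) i) else 0%N.
have nM : (n <= \sum_i M i + m)%N.
  rewrite leqNgt; apply/negP => Mn.
  (* Otherwise all minima over [C] can be raised by one within the total [n]; with the remainder put
     on [i1], this gives a lattice point violating dominance. *)
  pose N i := if i \in C then (val (f i) i).+1 else 0%N.
  have NM : (\sum_i N i <= \sum_i M i + m.+1)%N.
    rewrite -[X in (_ + X)%N](card_ord m.+1) -sum1_card -big_split /=.
    by apply: leq_sum => i _; rewrite /N /M; case: ifP => // _; rewrite addn1.
  have Nn : (\sum_i N i <= n)%N by rewrite (leq_trans NM)// addnS.
  pose t i := (N i + (if i == i1 then n - \sum_i N i else 0))%N.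
  have tn : (\sum_i t i = n)%N.
    rewrite big_split /= (bigD1 i1 (F := fun i => if i == i1 then _ else _))//= eqxx.
    rewrite [X in (_ + (_ + X))%N]big1 ?addn0 ?subnKC//.
    by move=> i /negbTE ->.
  have tlt i : (t i < n.+1)%N.
    by rewrite ltnS -[leqRHS]tn (bigD1 i)//= leq_addr.
  have tP : (\sum_i [ffun i => Ordinal (tlt i)] i == n)%N.
    by rewrite -[X in _ == X]tn; apply/eqP/eq_bigr => i _; rewrite ffunE.
  have [i iC] := dominantP _ _ _ _ _ sC (mk _ tP).
  move=> /(_ (f i) (fs i)); rewrite leqNgt => /negP; apply.
  by apply: rk_lt => /=; rewrite ffunE /= /t /N iC addSn ltnS leq_addr.
have Ms i x : x \in s -> (M i <= val x i)%N.
  by move=> xs; rewrite /M; case: ifP => // _; exact: fle.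
have sM i x : x \in s -> (val x i <= M i + m)%N.
  move=> xs; have : (\sum_i M i + (val x i - M i) <= n)%N.
    rewrite -[leqRHS](eqP (valP x)) (bigD1 i)//= [leqRHS](bigD1 i)//=.
    rewrite addnAC subnKC ?Ms// leq_add2l.
    by apply: leq_sum => j _; exact: Ms.
  move=> /leq_trans /(_ nM); rewrite leq_add2l.
  have := Ms i x xs; lia.
case/set0Pn: sn0 => s0 s0s.
pose pk i := [pick x | (x \in s) && (c x == i)].
exists s0, pk => i; rewrite /pk; case: pickP => [x /andP[xs /eqP cxi]|nx].
  split => // j; have := sM j x xs; have := sM j s0 s0s.
  have := Ms j x xs; have := Ms j s0 s0s; lia.
have iC : i \notin C.
  rewrite -cs; apply/negP => /imsetP[x xs ix].
  by have := nx x; rewrite xs ix eqxx.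
by have := sM i s0 s0s; rewrite /M (negbTE iC).
Qed.

End lattice.

(** * Limits of finite sums, maxima and minima *)

Lemma cvg_sumr (R : realType) (T J : Type) (F : set_system T) (r : seq J)
    (f : J -> T -> R) (a : J -> R) {FF : Filter F} :
  (forall j, f j x @[x --> F] --> a j) ->
  \sum_(j <- r) f j x @[x --> F] --> \sum_(j <- r) a j.
Proof. by move=> fa; apply: cvg_big => //; exact: add_continuous. Qed.

Lemma cvg_maxr (R : realType) (T : Type) (F : set_system T) (f g : T -> R)
    (a b : R) {FF : Filter F} : f x @[x --> F] --> a -> g x @[x --> F] --> b ->
  Num.max (f x) (g x) @[x --> F] --> Num.max a b.
Proof.
move=> fa gb; rewrite maxr_absE; under eq_cvg do rewrite maxr_absE.
by apply: cvgMl; apply: cvgD; [exact: cvgD|apply: cvg_norm; exact: cvgB].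
Qed.

Lemma cvg_minr (R : realType) (T : Type) (F : set_system T) (f g : T -> R)
    (a b : R) {FF : Filter F} : f x @[x --> F] --> a -> g x @[x --> F] --> b ->
  Num.min (f x) (g x) @[x --> F] --> Num.min a b.
Proof.
move=> fa gb; rewrite minr_absE; under eq_cvg do rewrite minr_absE.
by apply: cvgMl; apply: cvgB; [exact: cvgD|apply: cvg_norm; exact: cvgB].
Qed.

(** * From lattice points to continuous functions on the simplex *)

Section simplex.
Variables (R : realType) (m : nat).

Definition simplex : set 'rV[R]_m.+1 :=
  [set x | (forall i, 0 <= x ord0 i) /\ \sum_i x ord0 i = 1].

Lemma simplex_le1 x i : simplex x -> x ord0 i <= 1.
Proof. by move=> [x0 <-]; rewrite (bigD1 i)//= lerDl sumr_ge0. Qed.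

Lemma simplex_closed : closed simplex.
Proof.
have -> : simplex = (\bigcap_(i in [set: 'I_m.+1]) [set x | 0 <= x ord0 i]) `&`
    [set x | \sum_i x ord0 i = 1].
  by apply/seteqP; split=> x [x0 x1]; split => // i; [move=> _|]; exact: x0.
apply: closedI; first apply: closed_bigI => i _.
  apply: (@closed_comp _ _ (fun x : 'rV[R]_m.+1 => x ord0 i) [set y | 0 <= y]).
    by move=> x _; exact: coord_continuous.
  exact: closed_ge.
apply: (@closed_comp _ _ (fun x : 'rV[R]_m.+1 => \sum_i x ord0 i) [set 1]).
  move=> x _; apply: (@cvg_sumr _ _ _ (nbhs x)) => i; exact: coord_continuous.
exact: closed_eq.
Qed.

Lemma simplex_compact : compact simplex.
Proof.
have := @rV_compact R m.+1 (fun=> `[0, 1]%classic) (fun=> @segment_compact _ _ _).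
move=> /(subclosed_compact simplex_closed); apply.
move=> x xs i /=; rewrite in_itv/= simplex_le1// andbT.
by case: xs.
Qed.

(* Scarf's lemma on the lattice points k/n, with a colour i such that h_i >= 0. *)
Lemma simplex_approx (h : 'I_m.+1 -> 'rV[R]_m.+1 -> R) (n : nat) : (0 < n)%N ->
  (forall x, simplex x -> 0 <= \sum_i h i x) ->
  exists2 x, simplex x & forall i, x ord0 i <= m%:R / n%:R \/
    exists y, [/\ simplex y, 0 <= h i y & forall j, `|x ord0 j - y ord0 j| <= m%:R / n%:R].
Proof.
move=> n0 hge0.
pose T : finType := {k : {ffun 'I_m.+1 -> 'I_n.+1} | (\sum_i k i == n)%N}.
pose pt (k : T) : 'rV[R]_m.+1 := \row_i ((val k i)%:R / n%:R).
have n0R : (0 : R) < n%:R by rewrite ltr0n.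
have ptE (k : T) i : pt k ord0 i = (val k i)%:R / n%:R by rewrite mxE.
have ptS k : simplex (pt k).
  split=> [i|]; first by rewrite ptE divr_ge0.
  under eq_bigr do rewrite ptE.
  by rewrite -mulr_suml -natr_sum (eqP (valP k)) divff// gt_eqF.
have /choice[c cP] : forall k : T, exists i, 0 <= h i (pt k).
  move=> k; apply/existsP; apply: contraT => /existsPn kn.
  have := hge0 _ (ptS k); rewrite leNgt => /negP; case.
  rewrite big_ord_recl -[ltRHS]addr0 ltr_leD//; first by rewrite ltNge kn.
  by apply: sumr_le0 => i _; apply: ltW; rewrite ltNge kn.
have [s0 [s sP]] := lattice_scarf m n c.
exists (pt s0) => // i; have := sP i.
case: (s i) => [k [<- ks0]|s0m]; [right|left].
  exists (pt k); split => // j; rewrite !ptE -mulrBl normrM.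
  rewrite [X in _ * X]gtr0_norm ?invr_gt0// ler_pM2r ?invr_gt0//.
  have [kl lk] := ks0 j.
  rewrite ler_norml lerBlDl -natrD ler_nat lk andbT.
  by rewrite lerNl opprB lerBlDl -natrD ler_nat.
by rewrite ptE ler_pM2r ?invr_gt0// ler_nat.
Qed.

(** A KKM-type lemma: the closed sets where [h i] is nonnegative cover the simplex, and the [i]-th
    contains the face [x_i = 0]. A cluster point of the approximate solutions lies in all of
    them. *)
Lemma simplex_covering (h : 'I_m.+1 -> 'rV[R]_m.+1 -> R) :
  (forall i, {within simplex, continuous (h i)}) ->
  (forall x, simplex x -> 0 <= \sum_i h i x) ->
  (forall x i, simplex x -> x ord0 i = 0 -> 0 <= h i x) ->
  exists2 x, simplex x & forall i, 0 <= h i x.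
Proof.
move=> hc hge0 h0.
have /choice[x xP] : forall n, exists x, simplex x /\ forall i, x ord0 i <= m%:R / n.+1%:R \/
    exists y, [/\ simplex y, 0 <= h i y & forall j, `|x ord0 j - y ord0 j| <= m%:R / n.+1%:R].
  by move=> n; have [x xs xP] := simplex_approx h n.+1 isT hge0; exists x.
have [|p [ps pcl]] := @simplex_compact (x @ \oo) _.
  by exists 0%N => // n _ /=; have [] := xP n.
exists p => // i; rewrite leNgt; apply/negP => hp.
have pi0 : 0 < p ord0 i.
  rewrite lt_neqAle; have [p0 _] := ps; rewrite p0 andbT.
  by apply/eqP => /esym/(h0 _ _ ps); rewrite leNgt hp.
have /subspace_continuousP/(_ p ps)/cvgrPdist_lt/(_ (- h i p)) := hc i.
rewrite oppr_gt0 => /(_ hp); rewrite near_withinE => /nbhs_ballP[e /= e0 pe].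
(* Both the mesh and the distance from [p] to [x n] are below [d]. Their sum is then below
   [p ord0 i], which excludes a small [i]-th coordinate, and below [e], which puts [y] where [h i]
   is negative. *)
pose d := Num.min e (p ord0 i) / 2.
have d0 : 0 < d by rewrite divr_gt0// lt_min e0 pi0.
have [N Nd] : exists N, m%:R / N.+1%:R < d.
  exists (Num.truncn (m%:R / d)).
  rewrite ltr_pdivrMr// mulrC -ltr_pdivrMr//.
  exact: Num.Theory.truncnS_gt.
have [||_ [[n Nn <-]] [_ pxn]] := pcl [set x n | n in [set n | (N <= n)%N]] (ball p d).
- by exists N => // n Nn /=; exists n.
- exact: nbhsx_ballx.
have Nn' : m%:R / n.+1%:R <= m%:R / N.+1%:R :> R.
  by rewrite ler_wpM2l// lef_pV2 ?posrE// ler_nat ltnS.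
have [xs] := xP n.
case/(_ i) => [xi|[y [ys hy xy]]].
  have : d <= p ord0 i / 2 by rewrite ler_pM2r// ge_min lexx orbT.
  have : `|p ord0 i - x n ord0 i| < d by exact: pxn.
  have := le_lt_trans (le_trans xi Nn') Nd.
  by rewrite ltr_distl => ? /andP[_ ?] ?; lra.
have : ball p e y.
  split => // a j; rewrite ord1.
  have : d <= e / 2 by rewrite ler_pM2r// ge_min lexx.
  have := le_lt_trans (le_trans (xy j) Nn') Nd.
  have : `|p ord0 j - x n ord0 j| < d by exact: pxn.
  rewrite /ball /= !ltr_norml => /andP[? ?] /andP[? ?] ?.
  by apply/andP; split; lra.
move=> /pe/(_ ys); rewrite /from_subspace ltr_norml => /andP[+ _]; lra.
Qed.

(* Apply simplex_covering to h_i = g_i^+ - x_i S with S = sum_j g_j^+: since these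
   sum to 0, g_i^+ = x_i S for all i, which contradicts the hypothesis if S > 0. *)
Lemma simplex_gale (g : 'I_m.+1 -> 'rV[R]_m.+1 -> R) :
  (forall i, {within simplex, continuous (g i)}) ->
  (forall x, simplex x -> \sum_i x ord0 i * g i x <= 0) ->
  exists2 x, simplex x & forall i, g i x <= 0.
Proof.
move=> gc gle0.
pose S x := \sum_j Num.max (g j x) 0.
pose h i x := Num.max (g i x) 0 - x ord0 i * S x.
have [||x i _ xi0|x xs hx] := simplex_covering h.
- move=> i x; apply: cvgB.
    by apply: cvg_maxr; [exact: gc|exact: cvg_cst].
  apply: cvgM.
    apply: (@continuous_subspaceT _ _ simplex (fun x : 'rV[R]_m.+1 => x ord0 i)).
    exact: coord_continuous.
  by apply: cvg_sumr => j; apply: cvg_maxr; [exact: gc|exact: cvg_cst].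
- move=> x [_ x1]; rewrite sumrB -mulr_suml x1 mul1r subrr.
  exact: lexx.
- by rewrite /h xi0 mul0r subr0 le_max lexx orbT.
exists x => // i; have [x0 x1] := xs.
have S0 : 0 <= S x by apply: sumr_ge0 => j _; rewrite le_max lexx orbT.
have hE j : Num.max (g j x) 0 = x ord0 j * S x.
  apply/eqP; rewrite -subr_eq0; apply/eqP.
  have sh : \sum_j h j x = 0 by rewrite sumrB -mulr_suml x1 mul1r subrr.
  exact: (psumr_eq0P (fun j _ => hx j) sh).
suff Sx0 : S x = 0.
  by have := hE i; rewrite Sx0 mulr0 => <-; rewrite le_max lexx.
apply/eqP; rewrite eq_le S0 andbT leNgt; apply/negP => Spos.
have := gle0 _ xs; rewrite leNgt => /negP; apply.
(* Where [x ord0 j] is positive, so is the positive part of [g j x], which then equals [g j x]. The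
   sum becomes [S x] times a sum of squares, positive because the coordinates sum to 1. *)
have gE j : x ord0 j * g j x = x ord0 j * (x ord0 j * S x).
  have := x0 j; rewrite le_eqVlt => /orP[/eqP <-|xj]; first by rewrite !mul0r.
  congr (_ * _); rewrite -hE; have := hE j.
  have : 0 < x ord0 j * S x by exact: mulr_gt0.
  by rewrite maxEle; case: ifP => // _ + E; rewrite -E ltxx.
under eq_bigr do rewrite gE mulrA.
rewrite -mulr_suml pmulr_lgt0// lt_neqAle sumr_ge0 ?andbT; last first.
  by move=> j _; rewrite mulr_ge0.
apply/eqP => /esym xx0.
have : \sum_j x ord0 j = 0.
  apply: big1 => j _; apply/eqP; rewrite -sqrf_eq0 expr2.
  by rewrite (psumr_eq0P _ xx0)// => k _; rewrite mulr_ge0.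
by move/eqP; rewrite x1 oner_eq0.
Qed.

End simplex.

(** * Continuous functions on a compact subset *)

Section compact_continuous.
Variables (R : realType) (X : topologicalType) (A : set X).

(** Finite subcovers in filter form. The filter will be [\oo] for Dini's theorem, a neighbourhood
    filter for the tube lemma, and a filter of finite lists of deviations. *)
Lemma compact_near_all (I : Type) (F : set_system I) (P : I -> X -> Prop) :
  compact A -> Filter F ->
  (forall x, A x -> \forall y \near x & i \near F, A y -> P i y) ->
  \forall i \near F, forall x, A x -> P i x.
Proof.
move=> /compact_near_coveringP/near_covering_withinP cA FF AP.
exact: (cA I F P FF).
Qed.

Lemma within_continuous_near (f : X -> R) x e : {within A, continuous f} ->
  A x -> 0 < e -> \forall y \near x, A y -> `|f x - f y| < e.
Proof.
move=> /subspace_continuousP cf Ax e0.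
by have /cvgrPdist_lt/(_ _ e0) := cf x Ax; rewrite near_withinE.
Qed.

Lemma compact_within_bounded (f : X -> R) : compact A ->
  {within A, continuous f} -> exists M : R, forall x, A x -> `|f x| <= M.
Proof.
move=> cA cf; have := continuous_compact cf cA.
move=> /compact_bounded[M [_ Mf]]; exists (`|M| + 1) => x Ax.
apply: (Mf (`|M| + 1)); last by exists x.
by rewrite (le_lt_trans (ler_norm M))// ltrDl.
Qed.

Lemma within_continuous_sum (J : Type) (r : seq J) (f : J -> X -> R) :
  (forall j, {within A, continuous f j}) ->
  {within A, continuous (fun x => \sum_(j <- r) f j x)}.
Proof. by move=> cf x; apply: (@cvg_sumr _ _ _ (nbhs x)) => j; exact: cf. Qed.

Lemma within_continuousD (f g : X -> R) : {within A, continuous f} ->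
  {within A, continuous g} -> {within A, continuous (fun x => f x + g x)}.
Proof. by move=> cf cg x; apply: cvgD; [exact: cf|exact: cg]. Qed.

Lemma within_continuousB (f g : X -> R) : {within A, continuous f} ->
  {within A, continuous g} -> {within A, continuous (fun x => f x - g x)}.
Proof. by move=> cf cg x; apply: cvgB; [exact: cf|exact: cg]. Qed.

Lemma within_continuousM (f g : X -> R) : {within A, continuous f} ->
  {within A, continuous g} -> {within A, continuous (fun x => f x * g x)}.
Proof. by move=> cf cg x; apply: cvgM; [exact: cf|exact: cg]. Qed.

Lemma within_continuous_max (f g : X -> R) : {within A, continuous f} ->
  {within A, continuous g} ->
  {within A, continuous (fun x => Num.max (f x) (g x))}.
Proof. by move=> cf cg x; apply: cvg_maxr; [exact: cf|exact: cg]. Qed.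

Lemma within_continuous_min (f g : X -> R) : {within A, continuous f} ->
  {within A, continuous g} ->
  {within A, continuous (fun x => Num.min (f x) (g x))}.
Proof. by move=> cf cg x; apply: cvg_minr; [exact: cf|exact: cg]. Qed.

Lemma within_continuous_cst (a : R) : {within A, continuous (fun=> a)}.
Proof. by move=> x; exact: cvg_cst. Qed.

End compact_continuous.

(** * Measurability and integrability of continuous functions *)

Section borel.
Variables (R : realType) (X : ptopologicalType) (A : set X).

Lemma borel_open (O : set X) : open O -> measurable (O : set (borel X)).
Proof. by move=> oO; exact: sub_sigma_algebra. Qed.

Lemma borel_closed (O : set X) : closed O -> measurable (O : set (borel X)).
Proof. by move=> /closed_openC/borel_open/measurableC; rewrite setCK. Qed.

Lemma within_continuous_measurable (f : X -> R) :
  measurable (A : set (borel X)) -> {within A, continuous f} ->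
  measurable_fun (A : set (borel X)) (f : borel X -> R).
Proof.
move=> mA /continuousP cf; apply: (measurability _ (RGenOpens.measurableE R)).
move=> _ [_ [a [b ->] <-]].
have oab : open (`]a, b[%classic : set R) by exact: interval_open.
have /open_subspaceP[V oV VA] := cf _ oab.
rewrite setIC -VA; apply: measurableI => //; exact: borel_open.
Qed.

Lemma within_continuous_integrable (mu : probability (borel X) R) (f : X -> R) :
  compact A -> measurable (A : set (borel X)) -> {within A, continuous f} ->
  mu.-integrable A (EFin \o f).
Proof.
move=> cA mA cf; apply: measurable_bounded_integrable => //.
- by rewrite (le_lt_trans (probability_le1 _ _))// ltry.
- exact: within_continuous_measurable.
- have [M Mf] := compact_within_bounded _ _ _ _ cA cf.
  exists M; split; first exact: num_real.
  by move=> N MN x Ax /=; rewrite (le_trans (Mf _ Ax))// ltW.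
Qed.

End borel.

(** * The Riesz representation theorem on a compact set *)

Section riesz.
Variables (R : realType) (X : ptopologicalType) (A : set X).
Variable (L : (X -> R) -> R).
Local Notation C f := {within A, continuous f}.
Hypothesis cA : compact A.
Hypothesis mA : measurable (A : set (borel X)).
Hypothesis A_perfect : forall O : set X, open O -> exists g : X -> R,
  C g /\ forall x, A x -> 0 <= g x /\ (O x <-> 0 < g x).
Hypothesis LD : forall f g : X -> R, C f -> C g -> L (fun x => f x + g x) = L f + L g.
Hypothesis LZ : forall a (f : X -> R), C f -> L (fun x => a * f x) = a * L f.
Hypothesis L_ge0 : forall f : X -> R, C f -> (forall x, A x -> 0 <= f x) -> 0 <= L f.
Hypothesis L1 : L (fun=> 1) = 1.

Let Ccst (a : R) : C (fun=> a). Proof. exact: within_continuous_cst. Qed.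

Let LB (f g : X -> R) : C f -> C g -> L (fun x => f x - g x) = L f - L g.
Proof.
move=> cf cg; apply/eqP; rewrite eq_sym subr_eq -LD//; last first.
  exact: within_continuousB.
by apply/eqP; congr L; apply/funext => x; rewrite subrK.
Qed.

Let Lcst a : L (fun=> a) = a.
Proof. by rewrite -[in RHS](mulr1 a) -L1 -LZ//; congr L; apply/funext => x; rewrite mulr1. Qed.

Let L_le (f g : X -> R) : C f -> C g -> (forall x, A x -> f x <= g x) -> L f <= L g.
Proof.
move=> cf cg fg; rewrite -subr_ge0 -LB//; apply: L_ge0.
  exact: within_continuousB.
by move=> x Ax; rewrite subr_ge0 fg.
Qed.

Let L_sum n (f : nat -> X -> R) : (forall k, C (f k)) ->
  L (fun x => \sum_(k < n) f k x) = \sum_(k < n) L (f k).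
Proof.
move=> cf; elim: n => [|n ih].
  by rewrite big_ord0 -[RHS](Lcst 0); congr L; apply/funext => x; rewrite big_ord0.
rewrite big_ord_recr/= -ih -LD//; last exact: within_continuous_sum.
by congr L; apply/funext => x; rewrite big_ord_recr.
Qed.

(* Daniell's outer measure: b bounds E when, on A, the indicator of E is below the
   supremum of an increasing sequence of continuous functions with L (G n) <= b.
   Such sequences make countable subadditivity a diagonal argument. *)
Definition majorant (E : set X) (b : R) (G : nat -> X -> R) :=
  [/\ forall n, C (G n), forall n x, A x -> 0 <= G n x,
      forall m n x, (m <= n)%N -> A x -> G m x <= G n x,
      forall x c, A x -> E x -> c < 1 -> exists n, c < G n x &
      forall n, L (G n) <= b].

Definition bound E b := exists G, majorant E b G.

Let bound_ge0 E b : bound E b -> 0 <= b.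
Proof. by move=> [G [cG G0 _ _ Gb]]; apply: le_trans (Gb 0%N); apply: L_ge0 (G0 _). Qed.

Let bound1 E : bound E 1.
Proof.
exists (fun _ _ => 1); split=> //; last by move=> n; rewrite L1.
by move=> x c _ _ c1; exists 0%N.
Qed.

Let bound0 : bound set0 0.
Proof. by exists (fun _ _ => 0); split=> // n; rewrite Lcst. Qed.

Let bound_bigcup (E : nat -> set X) (b : nat -> R) s : (forall n, bound (E n) (b n)) ->
  (forall N, \sum_(n < N) b n <= s) -> bound (\bigcup_n E n) s.
Proof.
move=> /choice[G GE] bs.
(* At stage [N] only the first [N] sequences enter, each at its own stage [N]; nonnegativity and
   monotonicity of every [G n] make the sums increase. *)
exists (fun N x => \sum_(n < N) G n N x); split.
- move=> N; apply: (@within_continuous_sum _ _ _ _ _ (fun n : 'I_N => G n N)).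
  by move=> j; have [] := GE j.
- by move=> N x Ax; apply: sumr_ge0 => n _; have [_ G0 _ _ _] := GE n; exact: G0.
- move=> m n x mn Ax; rewrite (big_ord_widen n (fun i => G i m x) mn).
  apply: (@le_trans _ _ (\sum_(i < n | (i < m)%N) G i n x)).
    by apply: ler_sum => i _; have [_ _ + _ _] := GE i; exact.
  rewrite [leRHS](bigID (fun i : 'I_n => (i < m)%N))/= lerDl sumr_ge0// => i _.
  by have [_ + _ _ _] := GE i; exact.
- move=> x c Ax [n _ Enx] c1; have [_ G0 Gm + _] := GE n.
  move=> /(_ x c Ax Enx c1)[k ck].
  exists (maxn k n.+1); have nk : (n < maxn k n.+1)%N by rewrite leq_max leqnn orbT.
  apply: (lt_le_trans ck); apply: (le_trans (Gm _ _ _ (leq_maxl k n.+1) Ax)).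
  rewrite (bigD1 (Ordinal nk))//= lerDl sumr_ge0// => i _.
  by have [_ + _ _ _] := GE i; exact.
- move=> N; apply: le_trans (bs N); rewrite (L_sum N (fun n => G n N)); last first.
    by move=> k; have [] := GE k.
  by apply: ler_sum => n _; have [_ _ _ _] := GE n; exact.
Qed.

Definition riesz_outer (E : set X) : \bar R := ereal_inf [set b%:E | b in bound E].
Local Notation mu := riesz_outer.

Let mu_le_bound E b : bound E b -> (mu E <= b%:E)%E.
Proof. by move=> Eb; apply: ereal_inf_lbound; exists b. Qed.

Let mu_ge0 E : (0 <= mu E)%E.
Proof. by apply: le_ereal_inf_tmp => _ [b Eb <-]; rewrite lee_fin (bound_ge0 E). Qed.

Let mu_fin E : mu E \is a fin_num.
Proof.
by rewrite ge0_fin_numE// (le_lt_trans (mu_le_bound _ _ (bound1 E)))// ltry.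
Qed.

Let mu0 : mu set0 = 0%E.
Proof. by apply/eqP; rewrite eq_le mu_ge0 andbT; exact: mu_le_bound bound0. Qed.

Let le_mu : {homo mu : E F / E `<=` F >-> (E <= F)%E}.
Proof.
move=> E F EF; apply: le_ereal_inf_tmp => _ [b [G [? ? ? GF ?]] <-].
apply: mu_le_bound; exists G; split => // x c Ax /EF; exact: GF.
Qed.

Let mu_adherent E e : 0 < e -> exists2 b, bound E b & (b%:E <= mu E + e%:E)%E.
Proof.
move=> e0; have [_ [b Eb <-] be] := lb_ereal_inf_adherent e0 (mu_fin E).
by exists b => //; exact: ltW.
Qed.

Let mu_sigma_subadditive : sigma_subadditive mu.
Proof.
move=> E; apply/lee_addgt0Pr => e e0.
rewrite (le_trans _ (epsilon_trick _ _ (ltW e0)))//.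
have /choice[b bP] : forall n, exists b, bound (E n) b /\
    (b%:E <= mu (E n) + (e / (2 ^ n.+1)%:R)%:E)%E.
  move=> n; have [|b ? ?] := mu_adherent (E n) (e / (2 ^ n.+1)%:R).
    by rewrite divr_gt0// ltr0n expn_gt0.
  by exists b.
have b0 n : 0 <= b n by have [/bound_ge0] := bP n.
apply: (@le_trans _ _ (\sum_(n <oo) (b n)%:E)%E); last first.
  by apply: lee_nneseries => [n _ _|n _]; [rewrite lee_fin|have [] := bP n].
have [->|] := eqVneq (\sum_(n <oo) (b n)%:E)%E +oo%E; first by rewrite leey.
rewrite -ltey -ge0_fin_numE; last by apply: nneseries_ge0 => n _ _; rewrite lee_fin.
move=> bfin; rewrite -(fineK bfin); apply: mu_le_bound; apply: (bound_bigcup _ b) => [n|N].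
  by have [] := bP n.
rewrite -lee_fin fineK// -sumEFin -(big_mkord xpredT (fun i => (b i)%:E)).
by apply: nneseries_lim_ge => n _ _; rewrite lee_fin.
Qed.

HB.instance Definition _ := isOuterMeasure.Build R X riesz_outer
  mu0 mu_ge0 le_mu mu_sigma_subadditive.

(* An open set is cut out by the continuous functions w n, which decrease to the
   indicator of its complement on A. *)
Let open_caratheodory (O : set X) : open O -> caratheodory_measurable mu O.
Proof.
move=> /A_perfect[g [cg gP]]; apply: le_caratheodory_measurable => E /=.
apply: le_ereal_inf_tmp => _ [b [G [cG G0 Gm GE Gb]] <-].
pose w n x := Num.max (1 - n%:R * g x) 0.
have cw n : C (w n).
  apply: within_continuous_max; last exact: Ccst.
  by apply: within_continuousB; [exact: Ccst|apply: within_continuousM => //; exact: Ccst].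
have w0 n x : 0 <= w n x by rewrite le_max lexx orbT.
have w1 n x : A x -> w n x <= 1.
  by move=> /gP[gx0 _]; rewrite ge_max ler01 andbT gerBl mulr_ge0.
have wm m n x : (m <= n)%N -> A x -> w n x <= w m x.
  move=> mn /gP[gx0 _]; rewrite ge_max w0 andbT le_max lerB//.
  by rewrite ler_wpM2r// ler_nat.
pose H n x := G n x * (1 - w n x).
have cH n : C (H n).
  apply: within_continuousM; first exact: cG.
  by apply: within_continuousB; [exact: Ccst|exact: cw].
(* Outside [O] the factor [w n] is 1 on [A], so [G (k + n) * w n] majorises. Together with [H n] it
   stays below [G (k + n)], whose [L]-value is at most [b]. *)
have EO n : (mu (E `&` ~` O) <= (b - L (H n))%:E)%E.
  apply: mu_le_bound; exists (fun k x => G (k + n)%N x * w n x).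
  split=> [k|k x Ax|k l x kl Ax|x c Ax [Ex nOx] c1|k].
  - by apply: within_continuousM; [exact: cG|exact: cw].
  - by rewrite mulr_ge0// G0.
  - by rewrite ler_wpM2r// Gm// leq_add2r.
  - have [k ck] := GE x c Ax Ex c1; exists k.
    have [gx0 Ogx] := gP x Ax.
    have gx : g x = 0.
      by apply/eqP; rewrite eq_le gx0 andbT leNgt; apply/negP => /Ogx.
    rewrite /w gx mulr0 subr0 max_l// mulr1 (lt_le_trans ck)// Gm//.
    exact: leq_addr.
  - rewrite lerBrDr; apply: le_trans (Gb (k + n)%N).
    rewrite -LD//; last by apply: within_continuousM; [exact: cG|exact: cw].
    apply: L_le; [|exact: cG|].
      by apply: within_continuousD => //; apply: within_continuousM; [exact: cG|exact: cw].
    move=> x Ax; rewrite /H -lerBrDl.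
    have -> : G (k + n)%N x - G (k + n)%N x * w n x = G (k + n)%N x * (1 - w n x).
      by rewrite mulrBr mulr1.
    by apply: ler_wpM2r; rewrite ?subr_ge0 ?w1//; apply: Gm => //; exact: leq_addl.
(* The inequalities [EO], solved for [L (H n)], are the bounds that make [H] a majorant of the part
   inside [O]. *)
have EOb : bound (E `&` O) (b - fine (mu (E `&` ~` O))).
  exists H; split=> [//|n x Ax|m n x mn Ax|x c Ax [Ex Ox] c1|n].
  - by rewrite mulr_ge0 ?G0// subr_ge0 w1.
  - by apply: ler_pM; rewrite ?G0 ?subr_ge0 ?w1// ?Gm// lerB// wm.
  - have [k ck] := GE x c Ax Ex c1.
    have gx : 0 < g x by have [_ <-] := gP x Ax.
    pose N := Num.truncn (g x)^-1.
    exists (maxn k N.+1); rewrite /H.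
    have -> : w (maxn k N.+1) x = 0.
      apply: max_r; rewrite subr_le0 -ler_pdivrMr// mul1r.
      apply: (@le_trans _ _ N.+1%:R); first by rewrite ltW// Num.Theory.truncnS_gt.
      by rewrite ler_nat leq_maxr.
    by rewrite subr0 mulr1 (lt_le_trans ck)// Gm// leq_maxl.
  - rewrite lerBrDr addrC -lerBrDr -lee_fin fineK//; exact: EO.
have := mu_le_bound _ _ EOb.
by rewrite EFinB fineK// leeBrDr.
Qed.

Let borel_caratheodory (B : set (borel X)) : measurable B ->
  caratheodory_measurable mu B.
Proof.
move: B; apply: smallest_sub; last exact: open_caratheodory.
split; first exact: caratheodory_measurable_set0.
  by move=> B cB; rewrite setTD; exact: caratheodory_measurable_setC.
by move=> F cF; exact: caratheodory_measurable_bigcup.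
Qed.

(** Dini's argument: where [f] is positive, a majorant exceeds every [c < 1], hence [f - e]; being
    increasing, it does so at one stage on the whole compact set. *)
Let L_le_mu (f : X -> R) : C f -> (forall x, A x -> 0 <= f x <= 1) ->
  ((L f)%:E <= mu [set x | 0 < f x]%R)%E.
Proof.
move=> cf f01; apply: le_ereal_inf_tmp => _ [b [G [cG G0 Gm GE Gb]] <-].
rewrite lee_fin; apply/ler_addgt0Pr => e e0.
have [N _ /(_ N (leqnn N))/= fG] : \forall n \near \oo, forall x, A x -> f x <= G n x + e.
  apply: (compact_near_all _ _ _ _ _ cA) => x Ax.
  have e2 : 0 < e / 2 by rewrite divr_gt0.
  have [k ck] : exists k, f x - e / 4 < G k x.
    have /andP[f0 f1] := f01 x Ax; move: f0; rewrite le_eqVlt => /orP[/eqP f0|f0].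
      by exists 0%N; rewrite -f0; apply: lt_le_trans (G0 _ _ Ax); lra.
    by apply: GE => //; lra.
  have /= nf := within_continuous_near _ _ _ (fun y => f y - G k y) x (e / 2)
    (within_continuousB _ _ _ _ _ cf (cG k)) Ax e2.
  exists ([set y | A y -> `|f x - G k x - (f y - G k y)| < e / 2], [set n | (k <= n)%N]).
    by split => //=; exists k.
  move=> [y n] /= [yP kn] Ay; have := yP Ay; rewrite ltr_distl => /andP[? _].
  by have := Gm _ _ y kn Ay; lra.
apply: (@le_trans _ _ (L (fun x => G N x + e))).
  by apply: L_le => //; apply: within_continuousD => //; exact: Ccst.
by rewrite LD// Lcst lerD2r.
Qed.

(** Majorants are tested on [A] only, so the resulting measure is carried by [A]. *)
Let muIA E : mu (E `&` A) = mu E.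
Proof.
apply/eqP; rewrite eq_le le_mu//=.
apply: le_ereal_inf_tmp => _ [b [G [? ? ? GE ?]] <-].
apply: mu_le_bound; exists G; split => // x c Ax Ex; exact: GE.
Qed.

Let mu_setT : mu setT = 1%E.
Proof.
apply/eqP; rewrite eq_le mu_le_bound//=.
have := L_le_mu (fun=> 1) (Ccst 1).
rewrite L1 => /(_ _)/le_trans; apply; last by apply: le_mu.
by move=> x _; rewrite ler01 lexx.
Qed.

Definition riesz_measure (B : set (borel X)) : \bar R := riesz_outer B.

Let rm0 : riesz_measure set0 = 0%E. Proof. exact: mu0. Qed.
Let rm_ge0 B : (0 <= riesz_measure B)%E. Proof. exact: mu_ge0. Qed.
Let rm_sigma_additive : semi_sigma_additive riesz_measure.
Proof.
move=> F mF tF mUF; apply: (@caratheodory_measure_sigma_additive _ _ riesz_outer) => //.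
  by move=> i; exact: borel_caratheodory.
exact: borel_caratheodory.
Qed.

HB.instance Definition _ := isMeasure.Build _ _ _ riesz_measure
  rm0 rm_ge0 rm_sigma_additive.

Let rm_setT : riesz_measure setT = 1%E. Proof. exact: mu_setT. Qed.

HB.instance Definition _ :=
  Measure_isProbability.Build _ _ _ riesz_measure rm_setT.

Let rmA : riesz_measure A = 1%E.
Proof. by rewrite -rm_setT; have := muIA setT; rewrite setTI. Qed.

Let Rint_cst (r : R) : Rintegral riesz_measure A (fun=> r) = r.
Proof.
rewrite Rintegral_cst// -[RHS]mulr1; congr (_ * _).
exact: (congr1 fine rmA).
Qed.

(** * Layer-cake comparison of the functional with the integral *)

Let sum_clamp (y : R) m : 0 <= y ->
  \sum_(j < m) Num.min 1 (Num.max (y - j%:R) 0) = Num.min m%:R y.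
Proof.
move=> y0; elim: m => [|m ih]; first by rewrite big_ord0 min_l.
rewrite big_ord_recr/= ih -natr1.
by rewrite !minEle !maxEle; repeat case: ifPn; rewrite -?ltNge; lra.
Qed.

(** The bound by [m] is there for the induction: a new unit is added only when [m < y]. *)
Let sum_step (y : R) m : 0 <= y ->
  \sum_(j < m) (if j%:R < y then 1 else 0) <= Num.min m%:R (y + 1).
Proof.
move=> y0; elim: m => [|m]; first by rewrite big_ord0 le_min lexx/=; lra.
rewrite big_ord_recr/= -natr1; move: (\sum_(_ < m) _) => S.
by rewrite !minEle; repeat case: ifPn; rewrite -?ltNge; lra.
Qed.

(** Cut [M * f] into [M] slices of height 1. The [j]-th has [L]-value at most the measure of the set
    where [j < M * f], and these indicators sum to at most [M * f + 1]. Dividing by [M] makes the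
    error vanish in the limit. *)
Let L_le_integral (f : X -> R) : C f -> (forall x, A x -> 0 <= f x <= 1) ->
  L f <= Rintegral riesz_measure A f.
Proof.
move=> cf f01.
have intf : riesz_measure.-integrable A (EFin \o f).
  exact: within_continuous_integrable.
have int1 : riesz_measure.-integrable A (EFin \o (fun=> 1 : R)).
  exact: within_continuous_integrable.
have key m : m.+1%:R * L f <= m.+1%:R * Rintegral riesz_measure A f + 1.
  pose M : R := m.+1%:R.
  have cMf : C (fun x => M * f x) by apply: within_continuousM => //; exact: Ccst.
  have intMf : riesz_measure.-integrable A (EFin \o (fun x => M * f x)).
    exact: within_continuous_integrable.
  pose phi (j : nat) x := Num.min 1 (Num.max (M * f x - j%:R) 0).
  have cphi j : C (phi j).
    apply: within_continuous_min; first exact: Ccst.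
    apply: within_continuous_max; last exact: Ccst.
    by apply: within_continuousB => //; exact: Ccst.
  have cSphi : C (fun x => \sum_(j < m.+1) phi j x).
    exact: within_continuous_sum.
  pose S (j : nat) := A `&` [set x | j%:R < M * f x].
  have mS j : measurable (S j : set (borel X)).
    have := within_continuous_measurable _ _ _ _ mA cMf mA _ (measurable_itv `]j%:R, +oo[).
    by rewrite preimage_itvoy.
  have phiS j : ((L (phi j))%:E <= riesz_measure (S j))%E.
    apply: (le_trans (L_le_mu _ (cphi j) _)).
      by move=> x _; rewrite /phi le_min ler01 le_max lexx orbT ge_min lexx.
    rewrite -[leLHS]muIA; apply: le_mu => x [/= phix Ax]; split => //=.
    by move: phix; rewrite /phi lt_min ltr01 lt_max ltxx orbF subr_gt0.
  have -> : M * L f = \sum_(j < m.+1) L (phi j).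
    rewrite -L_sum// -LZ//; apply/eqP; rewrite eq_le; apply/andP.
    have Mfphi x : A x -> \sum_(j < m.+1) phi j x = M * f x.
      move=> /f01/andP[f0 f1]; rewrite sum_clamp ?mulr_ge0//.
      by rewrite min_r// ler_piMr.
    by split; apply: L_le => // x /Mfphi ->.
  rewrite -lee_fin -sumEFin.
  apply: (@le_trans _ _ (\sum_(j < m.+1) riesz_measure (S j))%E).
    by apply: lee_sum => j _; exact: phiS.
  have -> : (\sum_(j < m.+1) riesz_measure (S j) =
      \int[riesz_measure]_(x in A) \sum_(j < m.+1) (\1_(S j) x)%:E)%E.
    rewrite (@ge0_integral_sum _ _ _ riesz_measure A mA 'I_m.+1
      (fun j x => (\1_(S j) x)%:E)).
    - apply: eq_bigr => j _; rewrite integral_indic//.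
    - by move=> j; apply/measurable_EFinP.
    - by move=> j x _; rewrite lee_fin.
  apply: (@le_trans _ _ (\int[riesz_measure]_(x in A) (M * f x + 1)%:E)%E).
    apply: ge0_le_integral => //.
    - by move=> x _; apply: sume_ge0 => j _; rewrite lee_fin.
    - by apply: emeasurable_sum => j; apply/measurable_EFinP.
    - apply/measurable_EFinP; apply: within_continuous_measurable => //.
      by apply: within_continuousD => //; exact: Ccst.
    - move=> x Ax; rewrite sumEFin lee_fin; have /andP[f0 _] := f01 x Ax.
      apply: (@le_trans _ _ (Num.min m.+1%:R (M * f x + 1))); last first.
        by rewrite ge_min lexx orbT.
      apply: le_trans (sum_step _ _ _); last by rewrite mulr_ge0.
      apply: ler_sum => j _; rewrite indicE /S.
      case: ifPn => jMf; first by case: (_ \in _).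
      by rewrite memNset// => -[_ /=]; rewrite (negbTE jMf).
  have intM1 : riesz_measure.-integrable A (EFin \o (fun x => M * f x + 1)).
    apply: within_continuous_integrable => //.
    by apply: within_continuousD => //; exact: Ccst.
  rewrite -[leLHS]fineK; last exact: (integrable_fin_num mA intM1).
  rewrite lee_fin -[leLHS]/(Rintegral riesz_measure A (fun x => M * f x + 1)).
  rewrite RintegralD// RintegralZl// Rint_cst.
  exact: lexx.
rewrite leNgt; apply/negP => Lf.
have [m] : exists m, (L f - Rintegral riesz_measure A f)^-1 < m.+1%:R.
  by exists (Num.truncn (L f - Rintegral riesz_measure A f)^-1); exact: Num.Theory.truncnS_gt.
rewrite -[_^-1]mul1r ltr_pdivrMr ?subr_gt0//.
have := key m; lra.
Qed.

(** The reverse inequality is the previous one for [1 - f]. *)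
Let L_integral01 (f : X -> R) : C f -> (forall x, A x -> 0 <= f x <= 1) ->
  Rintegral riesz_measure A f = L f.
Proof.
move=> cf f01; apply/eqP; rewrite eq_le L_le_integral// andbT.
have c1f : C (fun x => 1 - f x) by apply: within_continuousB => //; exact: Ccst.
have := L_le_integral _ c1f.
rewrite LB// L1 RintegralB//; last 2 first.
- exact: within_continuous_integrable.
- exact: within_continuous_integrable.
rewrite Rint_cst lerD2l lerN2; apply.
by move=> x /f01/andP[? ?]; apply/andP; split; lra.
Qed.

Theorem riesz : exists2 m : PM R X, PMon R A m &
  forall f : X -> R, C f -> Rintegral m A f = L f.
Proof.
exists riesz_measure => [|f cf]; first exact: rmA.
have [M Mf] := compact_within_bounded _ _ _ _ cA cf.
(* A positive bound of [|f|], so that [g] rescales [f] affinely into the unit interval. *)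
pose N := `|M| + 1.
have N0 : 0 < N by rewrite /N ltr_wpDl.
pose g x := (2 * N)^-1 * (f x + N).
have cfN : C (fun x => f x + N) by apply: within_continuousD => //; exact: Ccst.
have cg : C g by apply: within_continuousM => //; exact: Ccst.
have fE : f = fun x => 2 * N * g x - N.
  by apply/funext => x; rewrite /g mulVKf ?addrK// mulf_neq0 ?gt_eqF//.
have g01 x : A x -> 0 <= g x <= 1.
  move=> /Mf; have := ler_norm M; rewrite ler_norml => ? /andP[? ?].
  rewrite /g mulrC ler_pdivlMr ?ler_pdivrMr ?mulr_gt0//; rewrite /N; lra.
move: g cg fE g01 => g cg -> g01.
have c2g : C (fun x => 2 * N * g x) by apply: within_continuousM => //; exact: Ccst.
rewrite LB// LZ// Lcst.
rewrite RintegralB ?RintegralZl ?Rint_cst//; try exact: within_continuous_integrable.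
by rewrite L_integral01.
Qed.

End riesz.

(** * The narrow topology *)

Lemma initial_cvgP (S : choiceType) (T : topologicalType) (f : S -> T)
    (F : set_system (initial_topology f)) (s : initial_topology f) : Filter F ->
  F --> s <-> f x @[x --> F] --> f s.
Proof.
move=> FF; split=> [Fs|Fs W].
  exact: cvg_comp Fs (@initial_continuous _ _ f s).
rewrite nbhsE => -[_ [[V oV <-] Vs] VW].
by apply: filterS VW _; apply: Fs; apply: open_nbhs_nbhs.
Qed.

Lemma prod_topology_cvgP (I : Type) (T : I -> topologicalType)
    (F : set_system (prod_topology T)) (f : prod_topology T) : Filter F ->
  F --> f <-> forall i, g i @[g --> F] --> f i.
Proof.
move=> FF; rewrite cvg_sup.
split=> Ff i; [exact/(initial_cvgP _ _ _ _ _ FF)/Ff|].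
exact/(initial_cvgP _ _ (fun g : forall i, T i => g i) _ _ FF)/Ff.
Qed.

Lemma ultra_compact_cvg (T : Type) (U : topologicalType) (F : set_system T)
    (f : T -> U) (K : set U) : UltraFilter F -> compact K -> F (f @^-1` K) ->
  exists2 c, K c & f x @[x --> F] --> c.
Proof.
move=> UF cK FK; have PF : ProperFilter F by exact: ultra_proper.
have [c [Kc clc]] := cK (f @ F) _ FK.
exists c => // B nB; have [//|FnB] := in_ultra_setVsetC (f @^-1` B) UF.
by have [y [nBy By]] := clc (~` B) B FnB nB.
Qed.

Section narrow.
Variables (R : realType) (X : ptopologicalType) (A : set X).

Lemma narrow_cvgP (F : set_system (narrow R A)) (mu : narrow R A) : Filter F ->
  F --> mu <-> forall f : X -> R, bounded_continuous_on R A f ->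
    Rintegral (nu : PM R X) A f @[nu --> F] --> Rintegral (mu : PM R X) A f.
Proof.
move=> FF; rewrite initial_cvgP prod_topology_cvgP.
by split=> [H f bcf|H [f bcf]]; [exact: (H (exist _ f bcf))|exact: H f bcf].
Qed.

Lemma narrow_integral_continuous (f : X -> R) : bounded_continuous_on R A f ->
  continuous (fun mu : narrow R A => Rintegral (mu : PM R X) A f).
Proof. by move=> bcf mu; have /narrow_cvgP : nbhs mu --> mu by []; exact. Qed.

Hypothesis cA : compact A.
Hypothesis mA : measurable (A : set (borel X)).

Lemma compact_bounded_continuous_on (f : X -> R) : {within A, continuous f} ->
  bounded_continuous_on R A f.
Proof. by move=> cf; split => //; exact: compact_within_bounded. Qed.

Lemma PMon_integral_cst (mu : PM R X) (a : R) : PMon R A mu ->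
  Rintegral mu A (fun=> a) = a.
Proof.
move=> muA; rewrite Rintegral_cst// -[RHS]mulr1; congr (_ * _).
exact: (congr1 fine muA).
Qed.

Lemma PMon_integral_le (mu : PM R X) (f : X -> R) (M : R) : PMon R A mu ->
  {within A, continuous f} -> (forall x, A x -> f x <= M) ->
  Rintegral mu A f <= M.
Proof.
move=> muA cf fM; rewrite -(PMon_integral_cst mu M muA).
apply: le_Rintegral => //; apply: within_continuous_integrable => //;
  exact: within_continuous_cst.
Qed.

Lemma PMon_integral_ge (mu : PM R X) (f : X -> R) (M : R) : PMon R A mu ->
  {within A, continuous f} -> (forall x, A x -> M <= f x) ->
  M <= Rintegral mu A f.
Proof.
move=> muA cf fM; rewrite -(PMon_integral_cst mu M muA).
apply: le_Rintegral => //; apply: within_continuous_integrable => //;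
  exact: within_continuous_cst.
Qed.

Lemma PMon_integral_norm_le (mu : PM R X) (f : X -> R) (M : R) : PMon R A mu ->
  {within A, continuous f} -> (forall x, A x -> `|f x| <= M) ->
  `|Rintegral mu A f| <= M.
Proof.
move=> muA cf fM; rewrite ler_norml; apply/andP; split.
  by apply: PMon_integral_ge => // x /fM; rewrite ler_norml => /andP[].
by apply: PMon_integral_le => // x /fM; rewrite ler_norml => /andP[].
Qed.

Hypothesis A_perfect : forall O : set X, open O -> exists g : X -> R,
  {within A, continuous g} /\ forall x, A x -> 0 <= g x /\ (O x <-> 0 < g x).

Lemma PMon_compact : compact (PMon R A : set (narrow R A)).
Proof.
rewrite compact_ultra => F UF FA.
have PF : ProperFilter F by exact: ultra_proper.
(* For continuous [f] the integrals stay in a segment, so they converge along the ultrafilter and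
   [lim] is a true limit. *)
pose L (f : X -> R) : R := lim (Rintegral (nu : PM R X) A f @[nu --> F]).
have Lcvg (f : X -> R) : {within A, continuous f} ->
    Rintegral (nu : PM R X) A f @[nu --> F] --> L f.
  move=> cf; have [M Mf] := compact_within_bounded _ _ _ _ cA cf.
  have [||c _ fc] := @ultra_compact_cvg _ _ F
    (fun nu : PM R X => Rintegral nu A f) `[- M, M]%classic UF.
  - exact: segment_compact.
  - apply: filterS FA => nu nuA /=; rewrite in_itv/= -ler_norml.
    exact: PMon_integral_norm_le.
  - by have -> : L f = c by exact: (cvg_lim (@Rhausdorff R) fc).
have int (nu : PM R X) (f : X -> R) : {within A, continuous f} ->
    nu.-integrable A (EFin \o f).
  by move=> cf; exact: within_continuous_integrable.
have LD (f g : X -> R) : {within A, continuous f} -> {within A, continuous g} ->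
    L (fun x => f x + g x) = L f + L g.
  move=> cf cg; apply: (cvg_lim (@Rhausdorff R)).
  have -> : (fun nu : PM R X => Rintegral nu A (fun x => f x + g x)) =
      (fun nu : PM R X => Rintegral nu A f + Rintegral nu A g).
    by apply/funext => nu; rewrite RintegralD//; exact: int.
  by apply: cvgD; exact: Lcvg.
have LZ (a : R) (f : X -> R) : {within A, continuous f} ->
    L (fun x => a * f x) = a * L f.
  move=> cf; apply: (cvg_lim (@Rhausdorff R)).
  have -> : (fun nu : PM R X => Rintegral nu A (fun x => a * f x)) =
      (fun nu : PM R X => a * Rintegral nu A f).
    by apply/funext => nu; rewrite RintegralZl//; exact: int.
  by apply: cvgMr; exact: Lcvg.
have L_ge0 (f : X -> R) : {within A, continuous f} ->
    (forall x, A x -> 0 <= f x) -> 0 <= L f.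
  move=> cf f0; apply: limr_ge; first by apply/cvg_ex; exists (L f); exact: Lcvg.
  by apply: nearW => nu; exact: Rintegral_ge0.
have L1 : L (fun=> 1) = 1.
  apply: (cvg_lim (@Rhausdorff R)); apply: cvg_near_cst.
  by apply: filterS FA => nu nuA; exact: PMon_integral_cst.
have [m mA1 mL] := riesz _ _ _ L cA mA A_perfect LD LZ L_ge0 L1.
exists m; split => //=; apply/narrow_cvgP => f [_ cf].
by rewrite mL//; exact: Lcvg.
Qed.

(* The Riesz theorem gives convex combinations without constructing them. *)
Lemma PMon_convex (m : nat) (mu : 'I_m.+1 -> PM R X) (a : 'I_m.+1 -> R) :
  (forall i, PMon R A (mu i)) -> (forall i, 0 <= a i) -> \sum_i a i = 1 ->
  exists2 nu : PM R X, PMon R A nu & forall f : X -> R, {within A, continuous f} ->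
    Rintegral nu A f = \sum_i a i * Rintegral (mu i) A f.
Proof.
move=> muA a0 a1.
have int (nu : PM R X) (f : X -> R) : {within A, continuous f} ->
    nu.-integrable A (EFin \o f).
  by move=> cf; exact: within_continuous_integrable.
apply: (riesz _ _ _ (fun f => \sum_i a i * Rintegral (mu i) A f)) => //.
- move=> f g cf cg; rewrite -big_split; apply: eq_bigr => i _ /=.
  by rewrite -mulrDr RintegralD//; exact: int.
- move=> b f cf; rewrite mulr_sumr; apply: eq_bigr => i _.
  rewrite RintegralZl//; last exact: int.
  by rewrite mulrCA.
- by move=> f cf f0; apply: sumr_ge0 => i _; rewrite mulr_ge0// Rintegral_ge0.
- rewrite -[RHS]a1; apply: eq_bigr => i _.
  by rewrite (PMon_integral_cst _ 1 (muA i)) mulr1.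
Qed.

Lemma PMon_nonempty : A !=set0 -> PMon R A !=set0.
Proof.
move=> [x Ax].
(* Evaluation at [x] is represented by the Dirac mass. *)
have [||||m mA1 _] := riesz _ _ _ (fun f => f x) cA mA A_perfect.
- by [].
- by [].
- by move=> f _; exact.
- by [].
- by exists m.
Qed.

End narrow.

(** * Jointly continuous payoffs *)

Lemma within_continuousP (R : realType) (X : topologicalType) (A : set X)
    (f : X -> R) : {within A, continuous f} <->
  forall x e, A x -> 0 < e -> \forall y \near x, A y -> `|f x - f y| < e.
Proof.
split=> [cf x e Ax e0|H]; first exact: within_continuous_near.
apply/subspace_continuousP => x Ax; apply/cvgrPdist_lt => e e0.
by rewrite near_withinE; exact: H.
Qed.

Lemma within_continuousV (R : realType) (X : topologicalType) (A : set X)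
    (f : X -> R) : (forall x, A x -> f x != 0) -> {within A, continuous f} ->
  {within A, continuous (fun x => (f x)^-1)}.
Proof.
move=> f0 /subspace_continuousP cf; apply/subspace_continuousP => x Ax.
by apply: cvgV; [exact: f0|exact: cf].
Qed.

Section product.
Variables (R : realType) (X Y : ptopologicalType) (A : set X) (B : set Y).
Variable (u : X -> Y -> R).
Hypotheses (cA : compact A) (cB : compact B).
Hypotheses (mA : measurable (A : set (borel X))) (mB : measurable (B : set (borel Y))).
Hypothesis A_perfect : forall O : set X, open O -> exists g : X -> R,
  {within A, continuous g} /\ forall x, A x -> 0 <= g x /\ (O x <-> 0 < g x).
Hypothesis cu : {within A `*` B, continuous (fun z : X * Y => u z.1 z.2)}.

Let cu_near a b (e : R) : A a -> B b -> 0 < e -> exists P Q, [/\ nbhs a P, nbhs b Q &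
  forall a' b', P a' -> Q b' -> A a' -> B b' -> `|u a b - u a' b'| < e].
Proof.
move=> Aa Bb e0; have /within_continuousP/(_ (a, b) e (conj Aa Bb) e0) := cu.
move=> [[P Q] /= [nP nQ] PQ]; exists P, Q; split => // a' b' Pa' Qb' Aa' Bb'.
exact: (PQ (a', b')).
Qed.

Let cu2 a : A a -> {within B, continuous (u a)}.
Proof.
move=> Aa; apply/within_continuousP => b e Bb e0.
have [P [Q [nP nQ PQ]]] := cu_near a b e Aa Bb e0.
by apply: filterS nQ => b' Qb' Bb'; apply: PQ => //; exact: nbhs_singleton nP.
Qed.

(** Compactness of [B] makes the estimate uniform in [b]. *)
Let tube a (e : R) : A a -> 0 < e -> exists V, [/\ open V, V a &
  forall a' b, V a' -> A a' -> B b -> `|u a' b - u a b| <= e].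
Proof.
move=> Aa e0.
have : \forall a' \near a, forall b, B b -> A a' -> `|u a' b - u a b| <= e.
  apply: (@compact_near_all _ _ _ _ (fun a' b => A a' -> `|u a' b - u a b| <= e) cB) => b Bb.
  have [P [Q [nP nQ PQ]]] := cu_near a b (e / 2) Aa Bb (divr_gt0 e0 (ltr0Sn _ _)).
  exists (Q, P); first by split.
  move=> [b' a'] /= [Qb' Pa'] Bb' Aa'.
  have h1 := PQ _ _ Pa' Qb' Aa' Bb'.
  have h2 := PQ _ _ (nbhs_singleton nP) Qb' Aa Bb'.
  move: h1 h2; rewrite !ltr_norml ler_norml => /andP[? ?] /andP[? ?].
  by apply/andP; split; lra.
move=> nS; exists (interior [set a' | forall b, B b -> A a' -> `|u a' b - u a b| <= e]).
split=> [|//|a' b /interior_subset/= Sa' Aa' Bb]; first exact: open_interior.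
exact: Sa'.
Qed.

(* A partition of unity on A subordinate to a finite cover by tubes. *)
Lemma separable_approx (e : R) : 0 < e -> exists (s : seq X) (f : X -> X -> R)
    (h : X -> Y -> R), [/\ forall j, {within A, continuous (f j)},
    forall j, {within B, continuous (h j)} &
    forall a b, A a -> B b -> `|u a b - \sum_(j <- s) f j a * h j b| <= e].
Proof.
move=> e0.
have /choice[V VP] : forall a, exists V, open V /\ (A a -> V a /\
    forall a' b, V a' -> A a' -> B b -> `|u a' b - u a b| <= e).
  move=> a; have [Aa|nAa] := pselect (A a).
    by have [V [? ? ?]] := tube a e Aa e0; exists V.
  by exists set0; split => //; exact: open0.
have /choice[g gP] : forall a, exists g : X -> R, {within A, continuous g} /\
    forall x, A x -> 0 <= g x /\ (V a x <-> 0 < g x).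
  by move=> a; apply: A_perfect; have [] := VP a.
move: cA; rewrite compact_cover => /(_ X A V).
case=> [a _|a Aa|D DA AD]; first by have [] := VP a.
  by exists a => //; have [_ /(_ Aa)[]] := VP a.
pose s : seq X := finmap.enum_fset D.
have sA j : j \in s -> A j by move=> js; have := DA j js; rewrite inE.
pose G a := \sum_(j <- s) g j a.
have G0 a : A a -> 0 < G a.
  move=> /[dup] Aa /AD[j /= jD Vj].
  rewrite /G (big_rem j)//=; apply: ltr_wpDr.
    by apply: sumr_ge0 => k _; have [_ /(_ a Aa)[]] := gP k.
  by have [_ /(_ a Aa)[_ [+ _]]] := gP j; exact.
have cG : {within A, continuous G}.
  by apply: within_continuous_sum => j; have [] := gP j.
(* Continuity of [u j] on [B] is known for [j] in [A] only; the default 0 makes every [h j]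
   continuous. *)
exists s, (fun j a => g j a * (G a)^-1), (fun j b => if j \in s then u j b else 0).
split.
- move=> j; apply: within_continuousM; first by have [] := gP j.
  by apply: within_continuousV => // x Ax; rewrite gt_eqF// G0.
- move=> j; have [js|_] := boolP (j \in s); last exact: within_continuous_cst.
  exact/cu2/sA.
move=> a b Aa Bb.
have G1 : \sum_(j <- s) g j a * (G a)^-1 = 1.
  by rewrite -mulr_suml divff// gt_eqF// G0.
rewrite -[u a b]mul1r -G1 mulr_suml -sumrB.
apply: le_trans (ler_norm_sum _ _ _) _.
rewrite -[leRHS]mul1r -G1 mulr_suml !big_seq; apply: ler_sum => j js.
rewrite js -mulrBr normrM.
have [_ /(_ a Aa)[gj0 [_ gV]]] := gP j.
have w0 : 0 <= g j a * (G a)^-1 by rewrite divr_ge0// ltW// G0.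
rewrite ger0_norm//.
(* A nonzero weight puts [a] in the tube [V j], where [u j b] is within [e] of [u a b]. *)
move: gj0; rewrite le_eqVlt => /orP[/eqP <-|gj0]; first by rewrite !mul0r.
apply: ler_wpM2l => //.
have [_ /(_ (sA j js))[_]] := VP j; apply => //; exact: gV.
Qed.

Let mAB : measurable (A `*` B : set (borel X * borel Y)%type).
Proof. exact: measurableX. Qed.

Let measurable1 (f : X -> R) : {within A, continuous f} ->
  measurable_fun (A `*` B : set (borel X * borel Y)%type) (fun z => f z.1).
Proof.
move=> cf _ V mV; have := within_continuous_measurable _ _ _ f mA cf mA V mV.
move=> mfV; rewrite (_ : _ `&` _ = (A `&` f @^-1` V) `*` B).
  exact: measurableX.
by apply/seteqP; split=> [[a b] [[/= ? ?] ?]|[a b] [[/= ? ?] ?]].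
Qed.

Let measurable2 (f : Y -> R) : {within B, continuous f} ->
  measurable_fun (A `*` B : set (borel X * borel Y)%type) (fun z => f z.2).
Proof.
move=> cf _ V mV; have := within_continuous_measurable _ _ _ f mB cf mB V mV.
move=> mfV; rewrite (_ : _ `&` _ = A `*` (B `&` f @^-1` V)).
  exact: measurableX.
by apply/seteqP; split=> [[a b] [[/= ? ?] ?]|[a b] [/= ? [? ?]]].
Qed.

Let measurable_separable (s : seq X) (f : X -> X -> R) (h : X -> Y -> R) :
  (forall j, {within A, continuous (f j)}) -> (forall j, {within B, continuous (h j)}) ->
  measurable_fun (A `*` B : set (borel X * borel Y)%type)
    (fun z => \sum_(j <- s) f j z.1 * h j z.2).
Proof.
move=> cf ch; apply: measurable_sum => j.
by apply: measurable_funM; [exact: measurable1|exact: measurable2].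
Qed.

(** The Borel sets of a product space may exceed the product sigma-algebra, so continuity alone does
    not suffice; [u] is measurable as a limit of separable sums. *)
Lemma measurable_joint : measurable_fun (A `*` B : set (borel X * borel Y)%type)
  (fun z => u z.1 z.2).
Proof.
have /choice[F FP] : forall n, exists F : (borel X * borel Y)%type -> R,
    measurable_fun (A `*` B : set (borel X * borel Y)%type) F /\
    forall z, (A `*` B) z -> `|u z.1 z.2 - F z| <= n.+1%:R^-1.
  move=> n; have [|s [f [h [cf ch fh]]]] := separable_approx n.+1%:R^-1.
    by rewrite invr_gt0.
  exists (fun z => \sum_(j <- s) f j z.1 * h j z.2); split.
    exact: measurable_separable.
  by move=> [a b] [Aa Bb]; exact: fh.
apply: (@measurable_fun_cvg _ _ _ _ F) => [n|z zAB]; first by have [] := FP n.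
apply/cvgrPdist_le => e e0; near=> n.
have [_ /(_ z zAB) H] := FP n.
apply: le_trans H (ltW _); near: n.
exact: (near_infty_natSinv_lt (PosNum e0)).
Unshelve. all: by end_near. Qed.

Local Notation AB := (A `*` B : set (borel X * borel Y)%type).

Variables (p : PM R X) (q : PM R Y).
Hypotheses (pA : PMon R A p) (qB : PMon R B q).

Let pqAB : (p \x q)%E AB = 1%E.
Proof.
rewrite product_measure1E// -[RHS]mule1; congr (_ * _)%E; [exact: pA|exact: qB].
Qed.

Let product_integrable (F : (borel X * borel Y)%type -> R) (M : R) :
  measurable_fun AB F -> (forall z, AB z -> `|F z| <= M) ->
  (p \x q)%E.-integrable AB (EFin \o F).
Proof.
move=> mF FM; apply: measurable_bounded_integrable => //.
- by move: pqAB => /= ->; rewrite ltry.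
- exists M; split; first exact: num_real.
  by move=> N MN z ABz /=; rewrite (le_trans (FM _ ABz))// ltW.
Qed.

Let product_integral_cst (a : R) : Rintegral (p \x q)%E AB (fun=> a) = a.
Proof.
rewrite Rintegral_cst// -[RHS]mulr1; congr (_ * _).
exact: (congr1 fine pqAB).
Qed.

Let separable_integrable (s : seq X) (f : X -> X -> R) (h : X -> Y -> R) :
  (forall j, {within A, continuous (f j)}) -> (forall j, {within B, continuous (h j)}) ->
  (p \x q)%E.-integrable AB (EFin \o (fun z => \sum_(j <- s) f j z.1 * h j z.2)).
Proof.
move=> cf ch.
have /choice[M MP] : forall j, exists M : R, forall a, A a -> `|f j a| <= M.
  by move=> j; exact: compact_within_bounded.
have /choice[K KP] : forall j, exists K : R, forall b, B b -> `|h j b| <= K.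
  by move=> j; exact: compact_within_bounded.
apply: (product_integrable _ (\sum_(j <- s) M j * K j)).
  exact: measurable_separable.
move=> [a b] [/= Aa Bb]; apply: le_trans (ler_norm_sum _ _ _) _.
by apply: ler_sum => j _; rewrite normrM ler_pM// ?MP ?KP.
Qed.

Let integral_product (f : X -> R) (h : Y -> R) : {within A, continuous f} ->
  {within B, continuous h} ->
  Rintegral (p \x q)%E AB (fun z => f z.1 * h z.2) =
  Rintegral p A f * Rintegral q B h.
Proof.
move=> cf ch.
(* Extension by zero moves the integral from the rectangle to the whole product, where Fubini's
   theorem applies. *)
pose F (z : (borel X * borel Y)%type) : R := (f \_ A) z.1 * (h \_ B) z.2.
have FE : (fun z => f z.1 * h z.2) \_ AB = F.
  apply/funext => -[a b]; rewrite /F !patchE in_setX /=.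
  by case: (a \in A); case: (b \in B); rewrite /= ?mulr0 ?mul0r.
have intf : p.-integrable setT (EFin \o (f \_ A)).
  rewrite -restrict_EFin -integrable_mkcond//.
  exact: within_continuous_integrable.
have inth : q.-integrable setT (EFin \o (h \_ B)).
  rewrite -restrict_EFin -integrable_mkcond//.
  exact: within_continuous_integrable.
rewrite [LHS]Rintegral_mkcond (Rintegral_mkcond p A) (Rintegral_mkcond q B) FE.
have intF : (p \x q)%E.-integrable setT (EFin \o F).
  rewrite -FE -restrict_EFin -integrable_mkcond//.
  (* A one-term sum; [point] is a dummy index. *)
  have := separable_integrable [:: point] (fun=> f) (fun=> h) (fun=> cf) (fun=> ch).
  apply: eq_integrable => //.
  by move=> z _ /=; rewrite big_seq1.
transitivity (fine (\int[p]_x fubini_F q (EFin \o F) x)%E).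
  by rewrite (integral12_prod_meas1 intF).
have -> : fubini_F q (EFin \o F) =
    EFin \o (fun x => (f \_ A) x * Rintegral q setT (h \_ B)).
  apply/funext => x; rewrite /fubini_F /= /F /= -RintegralZl//.
  rewrite /Rintegral fineK//.
  apply: integrable_fin_num => //.
  have := integrableZl measurableT ((f \_ A) x) inth.
  by apply: eq_integrable.
by rewrite -[LHS]/(Rintegral p setT _) RintegralZr.
Qed.

Let separable_integral (s : seq X) (f : X -> X -> R) (h : X -> Y -> R) :
  (forall j, {within A, continuous (f j)}) -> (forall j, {within B, continuous (h j)}) ->
  Rintegral (p \x q)%E AB (fun z => \sum_(j <- s) f j z.1 * h j z.2) =
  \sum_(j <- s) Rintegral p A (f j) * Rintegral q B (h j).
Proof.
move=> cf ch; elim: s => [|j s ih].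
  rewrite big_nil -[RHS](product_integral_cst 0); congr Rintegral.
  by apply/funext => z; rewrite big_nil.
rewrite big_cons -ih -integral_product// -RintegralD//.
- by congr Rintegral; apply/funext => z; rewrite big_cons.
- have := separable_integrable [:: j] f h cf ch.
  apply: eq_integrable => //.
  by move=> z _ /=; rewrite big_seq1.
- exact: separable_integrable.
Qed.

Let joint_integrable : (p \x q)%E.-integrable AB (EFin \o (fun z => u z.1 z.2)).
Proof.
have [M MP] := compact_within_bounded _ _ _ _ (compact_setX cA cB) cu.
exact: (product_integrable _ M measurable_joint).
Qed.

Lemma joint_integral_fin_num :
  (\int[p \x q]_(z in A `*` B) (u z.1 z.2)%:E)%E \is a fin_num.
Proof. exact: integrable_fin_num joint_integrable. Qed.

(** The product measure gives mass 1 to the rectangle, so a uniform error [e] integrates to at most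
    [e]. Payoffs thus reduce to finitely many integrals over single factors. *)
Lemma joint_integral_approx (s : seq X) (f : X -> X -> R) (h : X -> Y -> R) (e : R) :
  (forall j, {within A, continuous (f j)}) -> (forall j, {within B, continuous (h j)}) ->
  (forall a b, A a -> B b -> `|u a b - \sum_(j <- s) f j a * h j b| <= e) ->
  `|Rintegral (p \x q)%E AB (fun z => u z.1 z.2) -
    \sum_(j <- s) Rintegral p A (f j) * Rintegral q B (h j)| <= e.
Proof.
move=> cf ch fh.
have intu := joint_integrable; have ints := separable_integrable s f h cf ch.
have intd : (p \x q)%E.-integrable AB
    (EFin \o (fun z => u z.1 z.2 - \sum_(j <- s) f j z.1 * h j z.2)).
  have := integrableB mAB intu ints.
  by apply: eq_integrable.
rewrite -separable_integral// -RintegralB//.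
rewrite -[leRHS]product_integral_cst.
apply: le_trans (le_normr_Rintegral mAB intd) _.
apply: le_Rintegral => //.
- exact: (integrable_norm intd).
- apply: (product_integrable _ `|e|) => // z _; exact: lexx.
- by move=> [a b] [Aa Bb]; exact: fh.
Qed.

End product.

(** * Robust equilibria *)

Section game.
Variables (R : realType) (N : nat) (X : ptopologicalType) (A : 'I_N -> set X).
Variable (u : 'I_N -> ('I_N -> X) -> R).
Variable (S : forall i, ambiguity_map R N X i).
Hypothesis X_hausdorff : hausdorff_space X.
Hypothesis cA : forall i, compact (A i).
Hypothesis A0 : forall i, A i !=set0.
Hypothesis A_perfect : forall i (O : set X), open O -> exists g : X -> R,
  {within A i, continuous g} /\ forall x, A i x -> 0 <= g x /\ (O x <-> 0 < g x).
Hypothesis cu : forall i,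
  {within Aprof N X A, continuous (u i : {ptws 'I_N -> X} -> R)}.
Hypothesis S_adm : forall i, admissible_ambiguity R N X A i (S i).

Local Notation B i := (Aopp N X A i).

Let mA i : measurable (A i : set (borel X)).
Proof. by apply: borel_closed; exact: compact_closed. Qed.

Let cB i : compact (B i).
Proof. by apply: (@tychonoff (Defs.opp N i) (fun=> X) (fun j => A (val j))). Qed.

Let mB i : measurable (B i : set (borel (Xopp N X i))).
Proof.
apply: borel_closed.
have -> : B i = \bigcap_(j in [set: Defs.opp N i]) (@proj _ (fun=> X) j @^-1` A (val j)).
  by apply/seteqP; split=> [b bA j _|b bA j]; [exact: bA|exact: (bA j I)].
apply: closed_bigI => j _; apply: closed_comp.
  by move=> b _; exact: (@proj_continuous _ (fun=> X)).
exact: compact_closed.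
Qed.

Let w i (a : X) (b : Xopp N X i) : R := u i (Defs.join N X i a b).

Let join_continuous i : continuous
  (fun z : X * Xopp N X i => Defs.join N X i z.1 z.2 : {ptws 'I_N -> X}).
Proof.
move=> z; apply/prod_topology_cvgP => j.
suff H : Defs.join N X i z'.1 z'.2 j @[z' --> nbhs z] --> Defs.join N X i z.1 z.2 j.
  exact: H.
rewrite /Defs.join; case: insubP => [k _ _|_] /=; last exact: cvg_fst.
apply: (@cvg_comp _ _ _ snd (fun b : Xopp N X i => b k) _ (nbhs z.2)).
  exact: cvg_snd.
exact: (@proj_continuous _ (fun=> X) k z.2).
Qed.

Let join_Aprof i a b : A i a -> B i b -> Aprof N X A (Defs.join N X i a b).
Proof.
move=> Aa Bb j; rewrite /Defs.join; case: insubP => [k _ <-|]; first exact: Bb.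
by rewrite negbK => /eqP ->.
Qed.

Let cw i : {within A i `*` B i, continuous (fun z : X * Xopp N X i => w i z.1 z.2)}.
Proof.
apply/within_continuousP => -[a b] e [/= Aa Bb] e0.
have := within_continuous_near _ _ _ (u i : {ptws 'I_N -> X} -> R) _ e (cu i)
  (join_Aprof i a b Aa Bb) e0.
move=> /(join_continuous i (a, b)).
apply: (@filterS _ (nbhs ((a, b) : X * Xopp N X i)%type)) => -[a' b'] /= H [/= Aa' Bb'].
by apply: H; exact: join_Aprof.
Qed.

Definition payoff i (p : PM R X) (q : PM R (Xopp N X i)) : R :=
  Rintegral (p \x q)%E (A i `*` B i) (fun z => w i z.1 z.2).

Let UE i p q : PMon R (A i) p -> PMon R (B i) q ->
  U R N X A i (u i) p q = (payoff i p q)%:E.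
Proof.
move=> pA qB; rewrite /payoff /Rintegral fineK//.
exact: (joint_integral_fin_num _ _ _ _ _ (w i) (cA i) (cB i) (mA i) (mB i)
  (A_perfect i) (cw i) p q pA qB).
Qed.

Let payoff_approx i p q (s : seq X) (f : X -> X -> R)
    (h : X -> Xopp N X i -> R) (e : R) : PMon R (A i) p -> PMon R (B i) q ->
  (forall j, {within A i, continuous (f j)}) -> (forall j, {within B i, continuous (h j)}) ->
  (forall a b, A i a -> B i b -> `|w i a b - \sum_(j <- s) f j a * h j b| <= e) ->
  `|payoff i p q - \sum_(j <- s) Rintegral p (A i) (f j) * Rintegral q (B i) (h j)| <= e.
Proof.
move=> pA qB; exact: (joint_integral_approx _ _ _ _ _ (w i) (cA i) (cB i) (mA i)
  (mB i) (A_perfect i) (cw i) p q pA qB).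
Qed.

Let payoff_bounded i : exists M, forall p q, PMon R (A i) p -> PMon R (B i) q ->
  `|payoff i p q| <= M.
Proof.
have [M MP] := compact_within_bounded _ _ _ _ (compact_setX (cA i) (cB i)) (cw i).
exists M => p q pA qB.
(* The empty sum approximates the payoff function within its bound [M]. *)
have := payoff_approx i p q [::] (fun _ _ => 0) (fun _ _ => 0) M pA qB
  (fun=> @within_continuous_cst _ _ _ 0) (fun=> @within_continuous_cst _ _ _ 0).
rewrite [X in _ - X]big_nil subr0; apply=> a b Aa Bb.
by rewrite big_nil subr0; exact: (MP (a, b)).
Qed.

(** The mixture is known only through integrals over [A i]; separable sums carry the identity over
    to payoffs, up to an arbitrary [e]. *)
Let payoff_convex i (m : nat) (a : 'I_m.+1 -> R) (p : 'I_m.+1 -> PM R X)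
    (pbar : PM R X) q :
  (forall k, 0 <= a k) -> \sum_k a k = 1 -> (forall k, PMon R (A i) (p k)) ->
  PMon R (A i) pbar -> PMon R (B i) q ->
  (forall f : X -> R, {within A i, continuous f} ->
    Rintegral pbar (A i) f = \sum_k a k * Rintegral (p k) (A i) f) ->
  payoff i pbar q = \sum_k a k * payoff i (p k) q.
Proof.
move=> a0 a1 pA pbarA qB pbarE.
suff H e : 0 < e -> `|payoff i pbar q - \sum_k a k * payoff i (p k) q| <= e.
  apply/eqP; rewrite -subr_eq0 -normr_le0; apply/ler_addgt0Pr => e e0.
  by rewrite add0r H.
move=> e0; have e2 : 0 < e / 2 by rewrite divr_gt0.
have [s [f [h [cf ch fh]]]] :=
  separable_approx _ _ _ _ _ (w i) (cA i) (cB i) (A_perfect i) (cw i) (e / 2) e2.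
pose G (r : PM R X) := \sum_(j <- s) Rintegral r (A i) (f j) * Rintegral q (B i) (h j).
have GE : G pbar = \sum_k a k * G (p k).
  rewrite /G; under eq_bigr do rewrite pbarE// mulr_suml.
  rewrite exchange_big /=; apply: eq_bigr => k _.
  by rewrite mulr_sumr; apply: eq_bigr => j _; rewrite mulrA.
have -> : payoff i pbar q - \sum_k a k * payoff i (p k) q =
    (payoff i pbar q - G pbar) - \sum_k a k * (payoff i (p k) q - G (p k)).
  have -> : \sum_k a k * (payoff i (p k) q - G (p k)) =
      \sum_k a k * payoff i (p k) q - \sum_k a k * G (p k).
    by rewrite -sumrB; apply: eq_bigr => k _; rewrite mulrBr.
  by rewrite GE; ring.
apply: le_trans (ler_normB _ _) _; rewrite [leRHS]splitr lerD//.
  exact: payoff_approx.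
apply: le_trans (ler_norm_sum _ _ _) _.
rewrite -[leRHS]mul1r -[X in _ <= X * _]a1 mulr_suml; apply: ler_sum => k _.
by rewrite normrM ger0_norm// ler_wpM2l//; exact: payoff_approx.
Qed.

(** A real infimum; it agrees with [robust_value] for nonempty [Q] carried by the opponents'
    actions, since payoffs are bounded. *)
Definition robust_payoff i (p : PM R X) (Q : set (PM R (Xopp N X i))) : R :=
  inf [set payoff i p q | q in Q].

Section robust_payoff.
Variables (i : 'I_N) (p : PM R X) (Q : set (PM R (Xopp N X i))).
Hypotheses (pA : PMon R (A i) p) (QB : Q `<=` PMon R (B i)) (Q0 : Q !=set0).

Let has_inf_payoff : has_inf [set payoff i p q | q in Q].
Proof.
split; first by have [q Qq] := Q0; exists (payoff i p q); exists q.
have [M MP] := payoff_bounded i; exists (- M) => _ [q Qq <-].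
by have := MP p q pA (QB _ Qq); rewrite ler_norml => /andP[].
Qed.

Let robust_payoff_le q : Q q -> robust_payoff i p Q <= payoff i p q.
Proof. by move=> Qq; apply: ge_inf; [exact: (has_inf_payoff.2)|exists q]. Qed.

Let robust_payoff_adherent e : 0 < e ->
  exists2 q, Q q & payoff i p q < robust_payoff i p Q + e.
Proof.
by move=> e0; have [_ [q Qq <-] qe] := inf_adherent e0 has_inf_payoff; exists q.
Qed.

Let le_robust_payoff c : (forall q, Q q -> c <= payoff i p q) ->
  c <= robust_payoff i p Q.
Proof.
by move=> cQ; apply: lb_le_inf; [exact: has_inf_payoff.1|move=> _ [q /cQ ? <-]].
Qed.

Let robust_valueE : robust_value R N X A i (u i) Q p = (robust_payoff i p Q)%:E.
Proof.
rewrite /robust_value /robust_payoff -ereal_inf_EFin; last 2 first.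
- exact: has_inf_payoff.2.
- exact: has_inf_payoff.1.
congr ereal_inf; rewrite image_comp; apply/seteqP; split=> _ [q Qq <-]; exists q => //.
  by rewrite /= UE//; exact: QB.
by rewrite UE//; exact: QB.
Qed.

Lemma robust_payoffP : [/\ forall q, Q q -> robust_payoff i p Q <= payoff i p q,
  forall e, 0 < e -> exists2 q, Q q & payoff i p q < robust_payoff i p Q + e,
  forall c, (forall q, Q q -> c <= payoff i p q) -> c <= robust_payoff i p Q &
  robust_value R N X A i (u i) Q p = (robust_payoff i p Q)%:E].
Proof.
split; [exact: robust_payoff_le|exact: robust_payoff_adherent|
  exact: le_robust_payoff|exact: robust_valueE].
Qed.

End robust_payoff.

(** * Continuity of worst-case payoffs on the space of profiles *)

Definition profile : topologicalType :=
  prod_topology (fun i : 'I_N => narrow R (A i)).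
Definition strategies : set profile := [set x | forall i, PMon R (A i) (x i)].
Local Notation K := strategies.
Local Notation opponents i x := (Defs.minus R N X i x).

Let opponentsD i (x : profile) : K x -> DomSet R N X A i (opponents i x).
Proof. by move=> Kx j; exact: Kx. Qed.

Let opponents_continuous i :
  continuous (fun x : profile => opponents i x : Dom R N X A i).
Proof.
move=> x.
have FF : Filter ((fun x : profile => opponents i x : Dom R N X A i) @ nbhs x).
  exact: fmap_filter.
apply/(prod_topology_cvgP _ _ _ _ FF) => j.
have /(prod_topology_cvgP _ _ _ _ (nbhs_filter x)) : nbhs x --> x by [].
by move=> /(_ (val j)).
Qed.

Let SB i x : K x -> S i (opponents i x) `<=` PMon R (B i).
Proof. by move=> Kx; have [+ _ _ _ _] := S_adm i; apply; exact: opponentsD. Qed.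

Let S0 i x : K x -> S i (opponents i x) !=set0.
Proof. by move=> Kx; have [_ + _ _ _] := S_adm i; apply; exact: opponentsD. Qed.

Let value i p (x : profile) := robust_payoff i p (S i (opponents i x)).

Let valueP i p x (pA : PMon R (A i) p) (Kx : K x) :=
  robust_payoffP i p _ pA (SB i x Kx) (S0 i x Kx).

(** Berge's argument: upper hemicontinuity keeps all payoffs over nearby ambiguity sets from
    dropping much below the value, and lower hemicontinuity keeps a nearly worst [q] available. The
    open sets are cut out by [G p], a finite sum of integrals continuous on the whole narrow
    space. *)
Let value_continuous i (p : narrow R (A i)) (x : profile) (e : R) :
  PMon R (A i) p -> K x -> 0 < e ->
  exists P W, [/\ nbhs p P, nbhs x W & forall p' y, P p' -> W y ->
    PMon R (A i) p' -> K y -> `|value i p x - value i p' y| <= e].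
Proof.
(* Four errors [d] add up: two in the margin [2 * d] of the open sets, one for moving from [p] to
   [p'], one for returning from [G] to [payoff]. *)
move=> pA Kx e0; pose d := e / 4.
have d0 : 0 < d by rewrite divr_gt0.
have eE : e = 4 * d by rewrite /d; lra.
have [s [f [h [cf ch fh]]]] :=
  separable_approx _ _ _ _ _ (w i) (cA i) (cB i) (A_perfect i) (cw i) d d0.
pose G (r : PM R X) (q : PM R (Xopp N X i)) :=
  \sum_(j <- s) Rintegral r (A i) (f j) * Rintegral q (B i) (h j).
have GE r q : PMon R (A i) r -> PMon R (B i) q -> `|payoff i r q - G r q| <= d.
  by move=> rA qB; exact: payoff_approx.
have /choice[M MP] : forall j, exists M : R, forall b, B i b -> `|h j b| <= M.
  by move=> j; exact: compact_within_bounded.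
(* The weights [M j] bound the integrals of [h j] for every [q] at once, so [P] does not depend on
   [q]. *)
pose P : set (narrow R (A i)) := [set p' |
  \sum_(j <- s) `|Rintegral (p : PM R X) (A i) (f j) -
                  Rintegral (p' : PM R X) (A i) (f j)| * M j < d].
have nP : nbhs p P.
  have : \sum_(j <- s) `|Rintegral (p : PM R X) (A i) (f j) -
      Rintegral (p' : PM R X) (A i) (f j)| * M j @[p' --> p] --> \sum_(j <- s) (0 : R).
    have FF := nbhs_filter p.
    apply: (@cvg_sumr _ _ _ (nbhs p) _ _ _ FF) => j.
    rewrite -[X in _ --> X](mul0r (M j)); apply: cvgMl.
    rewrite -(normr0 R) -(subrr (Rintegral (p : PM R X) (A i) (f j))).
    apply: cvg_norm; apply: cvgB; first exact: cvg_cst.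
    apply: narrow_integral_continuous.
    exact: (compact_bounded_continuous_on _ _ _ (cA i)).
  rewrite big1// => /cvgrPdist_lt/(_ d d0); apply: filterS => p' /=.
  by rewrite sub0r normrN; apply: le_lt_trans; exact: ler_norm.
have GP p' q : P p' -> PMon R (B i) q -> `|G p q - G p' q| <= d.
  move=> Pp' qB; rewrite -sumrB; apply: le_trans (ltW Pp').
  apply: le_trans (ler_norm_sum _ _ _) _; apply: ler_sum => j _.
  rewrite -mulrBl normrM ler_wpM2l//.
  by apply: (PMon_integral_norm_le _ _ _ (cB i) (mB i)) => //; exact: MP.
have cG : continuous (G p : narrow R (B i) -> R).
  move=> q; have FF := nbhs_filter q.
  apply: (@cvg_sumr _ _ _ (nbhs q) _ _ _ FF) => j; apply: cvgMr.
  apply: narrow_integral_continuous.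
  exact: (compact_bounded_continuous_on _ _ _ (cB i)).
have oG (Z : set R) : open Z -> open (G p @^-1` Z : set (narrow R (B i))).
  by move: Z; apply/continuousP.
have [Vle Vad _ _] := valueP i p x pA Kx.
set v := robust_payoff i p _ in Vle Vad.
have [_ _ _ uhc lhc] := S_adm i.
have [||W1 [oW1 W1x W1P]] := uhc _ (opponentsD i x Kx) [set q | v - 2 * d < G p q].
- by apply: (oG [set y | v - 2 * d < y]); exact: open_gt.
- move=> q Sq /=; have := GE p q pA (SB i x Kx q Sq).
  by rewrite ler_norml => /andP[_ ?]; have := Vle q Sq; lra.
have [||W2 [oW2 W2x W2P]] := lhc _ (opponentsD i x Kx) [set q | G p q < v + 2 * d].
- by apply: (oG [set y | y < v + 2 * d]); exact: open_lt.
- have [q Sq qv] := Vad d d0; exists q; split => //=.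
  by have := GE p q pA (SB i x Kx q Sq); rewrite ler_norml => /andP[? _]; lra.
exists P, ((fun y : profile => opponents i y : Dom R N X A i) @^-1` (W1 `&` W2)).
split=> //.
  apply: opponents_continuous; apply: open_nbhs_nbhs; split; first exact: openI.
  by split.
move=> p' y Pp' [W1y W2y] p'A Ky.
have [Vle' _ leV' _] := valueP i p' y p'A Ky.
have [q [Sq Gq]] := W2P _ (opponentsD i y Ky) W2y.
have qB := SB i y Ky q Sq.
rewrite ler_distlC; apply/andP; split.
  apply: leV' => r Sr; have rB := SB i y Ky r Sr.
  have := W1P _ (opponentsD i y Ky) W1y r Sr.
  have := GP p' r Pp' rB; have := GE p' r p'A rB.
  rewrite !ler_norml => /andP[? ?] /andP[? ?] /= ?.
  by rewrite -[value i p x]/v eE; lra.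
apply: le_trans (Vle' q Sq) _.
have := GP p' q Pp' qB; have := GE p' q p'A qB; move: Gq => /=.
by rewrite !ler_norml => ? /andP[? ?] /andP[? ?]; rewrite -[value i p x]/v eE; lra.
Qed.

Let value_cvg_opponents i (p : PM R X) (x : profile) : PMon R (A i) p -> K x ->
  value i p x' @[x' --> within K (nbhs x)] --> value i p x.
Proof.
move=> pA Kx; apply/cvgrPdist_le => e e0.
have [P [W [nP nW PW]]] := value_continuous i p x e pA Kx e0.
rewrite near_withinE; apply: filterS nW => y Wy Ky.
by apply: PW => //; exact: (@nbhs_singleton (narrow R (A i))).
Qed.

Let value_cvg i (x : profile) : K x ->
  value i (x' i) x' @[x' --> within K (nbhs x)] --> value i (x i) x.
Proof.
move=> Kx; apply/cvgrPdist_le => e e0.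
have [P [W [nP nW PW]]] := value_continuous i (x i) x e (Kx i) Kx e0.
have nxP : nbhs x [set y | P (y i)].
  have /(prod_topology_cvgP _ _ _ _ (nbhs_filter x)) : nbhs x --> x by [].
  by move=> /(_ i); exact.
rewrite near_withinE; apply: filterS2 nW nxP => y Wy Py Ky.
by apply: PW => //; exact: Ky.
Qed.

(** * The Ky Fan inequality *)

Let phi (x y : profile) := \sum_i (value i (y i) x - value i (x i) x).

Let phi_cvg (x y : profile) : K x -> K y ->
  phi x' y @[x' --> within K (nbhs x)] --> phi x y.
Proof.
move=> Kx Ky; apply: (@cvg_sumr _ _ _ (within K (nbhs x))) => i.
by apply: cvgB; [exact: value_cvg_opponents|exact: value_cvg].
Qed.

Let strategies_compact : compact K.
Proof.
apply: (@tychonoff 'I_N (fun i => narrow R (A i)) (fun i => PMon R (A i))) => i.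
exact: (PMon_compact R X (A i) (cA i) (mA i) (A_perfect i)).
Qed.

(** All agents mix their components of the [y k] with the same weights [a]. The mixture [x a] is
    merely chosen with prescribed integrals, which is enough for continuity in [a], as the narrow
    topology sees nothing else. *)
Let finite_deviations (m : nat) (y : 'I_m.+1 -> profile) : (forall k, K (y k)) ->
  exists2 x, K x & forall k, phi x (y k) <= 0.
Proof.
move=> Ky.
have /choice[x xP] : forall a : 'rV[R]_m.+1, exists x : profile, simplex R m a ->
    K x /\ forall i (f : X -> R), {within A i, continuous f} ->
    Rintegral (x i : PM R X) (A i) f =
    \sum_k a ord0 k * Rintegral (y k i : PM R X) (A i) f.
  move=> a; have [[a0 a1]|na] := pselect (simplex R m a); last by exists (y ord0) => /na.
  have /choice[x xP] : forall i : 'I_N, exists x : PM R X, PMon R (A i) x /\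
      forall f : X -> R, {within A i, continuous f} ->
      Rintegral x (A i) f = \sum_k a ord0 k * Rintegral (y k i : PM R X) (A i) f.
    move=> i; have [|x xA xE] := PMon_convex _ _ _ (cA i) (mA i) (A_perfect i) m
      (fun k => y k i : PM R X) (fun k => a ord0 k) _ a0 a1; last by exists x.
    by move=> k; exact: Ky.
  exists x => _; split=> [i|i f cf]; first by have [] := xP i.
  by have [_] := xP i; exact.
have Kx a : simplex R m a -> K (x a) by move=> /xP[].
have xcvg a : simplex R m a ->
    x b @[b --> within (simplex R m) (nbhs a)] --> within K (nbhs (x a)).
  move=> sa; have FF : Filter (x @ within (simplex R m) (nbhs a)) by exact: fmap_filter.
  have H : x @ within (simplex R m) (nbhs a) --> x a.
    apply/(prod_topology_cvgP _ _ _ _ FF) => i.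
    have FFi : Filter ((fun b => x b i : narrow R (A i)) @ within (simplex R m) (nbhs a)).
      exact: fmap_filter.
    apply/(narrow_cvgP _ _ _ _ _ FFi) => f [_ cf].
    rewrite (xP a sa).2//.
    have : \sum_k b ord0 k * Rintegral (y k i : PM R X) (A i) f
        @[b --> within (simplex R m) (nbhs a)] -->
        \sum_k a ord0 k * Rintegral (y k i : PM R X) (A i) f.
      apply: (@cvg_sumr _ _ _ (within (simplex R m) (nbhs a))) => k.
      apply: cvgMl; move=> Z nZ.
      have H := @coord_continuous _ _ _ ord0 k a Z nZ.
      by apply: (@filterS _ (nbhs a) (nbhs_filter a) _ _ _ H) => b Zb _.
    apply: cvg_trans; apply: (@near_eq_cvg _ _ (within (simplex R m) (nbhs a)) _).
    rewrite near_withinE; by apply: nearW => b sb; rewrite (xP b sb).2.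
  move=> Z nZ; have HZ := H _ nZ.
  apply: (@filterS _ (nbhs a) (nbhs_filter a) _ _ _ HZ) => b HZb sb.
  exact: HZb sb (Kx b sb).
have [||a sa ga] := simplex_gale R m (fun k a => phi (x a) (y k)).
- move=> k; apply/subspace_continuousP => a sa.
  exact: (cvg_comp _ _ (xcvg a sa) (phi_cvg (x a) (y k) (Kx a sa) (Ky k))).
(* After exchanging the sums, each agent contributes the concavity inequality: the weighted sum of
   the values of the [y k i] is at most the value of their mixture. *)
- move=> a sa; have [a0 a1] := sa.
  rewrite /phi; under eq_bigr do rewrite mulr_sumr.
  rewrite exchange_big /=; apply: sumr_le0 => i _.
  under eq_bigr do rewrite mulrBr.
  rewrite sumrB -mulr_suml a1 mul1r subr_le0.
  have xaA := Kx a sa i.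
  have [_ _ leV _] := valueP i _ (x a) xaA (Kx a sa).
  apply: leV => q Sq.
  rewrite (payoff_convex i m (fun k => a ord0 k) (fun k => y k i : PM R X) (x a i) q)//.
  + apply: ler_sum => k _; rewrite ler_wpM2l//.
    have [Vle _ _ _] := valueP i _ (x a) (Ky k i) (Kx a sa).
    exact: Vle.
  + by move=> k; exact: Ky.
  + exact: (SB i (x a) (Kx a sa)).
  + by move=> f cf; have [_] := xP a sa; exact.
by exists (x a); [exact: Kx|].
Qed.

(** If every [x] had a profitable deviation, it would persist near [x], and compactness would give
    one finite list of deviations against all of [K], contradicting [finite_deviations]. *)
Let fan : exists2 x, K x & forall y, K y -> phi x y <= 0.
Proof.
apply: contrapT => nfan.
have dev (x : profile) : K x -> exists y, K y /\ 0 < phi x y.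
  move=> Kx; apply: contrapT => /forallNP ndev; apply: nfan; exists x => // y Ky.
  by rewrite leNgt; apply/negP => phi0; apply: (ndev y).
(* Finite lists directed by inclusion: a property holds near [F] if it holds for all lists
   containing some fixed list. *)
pose F : set_system (seq profile) :=
  filter_from [set: seq profile]
    (fun s : seq profile => [set t : seq profile | {subset s <= t}]).
have FF : Filter F.
  apply: filter_from_filter; first by exists [::].
  move=> s t _ _; exists (s ++ t) => // r str; split=> z zin; apply: str.
    by rewrite mem_cat zin.
  by rewrite mem_cat zin orbT.
have [s _ /(_ s (fun _ => id)) sP] : \forall s \near F, forall x, K x ->
    exists y, [/\ y \in s, K y & 0 < phi x y].
  apply: (compact_near_all _ _ _ _ (fun (s : seq profile) x =>
      exists y, [/\ y \in s, K y & 0 < phi x y])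
    strategies_compact) => x Kx.
  have [y [Ky phi0]] := dev x Kx.
  exists ([set x' | K x' -> 0 < phi x' y], [set s : seq profile | y \in s]).
    split=> /=; last by exists [:: y] => // t; apply; rewrite mem_head.
    have /cvgrPdist_lt/(_ _ phi0) := phi_cvg x y Kx Ky.
    rewrite near_withinE; apply: filterS => x' H /H.
    by rewrite ltr_distlC subrr => /andP[].
  by move=> [x' t] /= [H yt] Kx'; exists y; split => //; exact: H.
have [x0 Kx0] : exists x, K x.
  have /choice[x xP] : forall i, exists x : PM R X, PMon R (A i) x.
    by move=> i; have [x xA] := PMon_nonempty R X _ (cA i) (mA i) (A_perfect i) (A0 i);
      exists x.
  by exists x.
(* The list [s] may contain points outside [K]. What remains is nonempty, since the refutation of
   [x0] is in it, so it can be indexed by some ['I_m.+1]. *)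
pose t := [seq y <- s | `[< K y >]].
have tK y : y \in t -> K y by rewrite mem_filter => /andP[/asboolP].
have [y0 [y0s Ky0 _]] := sP x0 Kx0.
have t0 : (0 < size t)%N.
  rewrite size_filter -has_count; apply/hasP; exists y0 => //; exact/asboolP.
have [x Kx xP] := finite_deviations (size t).-1 (fun k => nth y0 t k) (fun k =>
  tK _ (mem_nth _ (leq_trans (ltn_ord k) (eq_leq (prednK t0))))).
have [y [ys Ky]] := sP x Kx.
have yt : y \in t by rewrite mem_filter ys andbT; exact/asboolP.
have it : (index y t < (size t).-1.+1)%N by rewrite prednK// index_mem.
by have := xP (Ordinal it); rewrite /= nth_index// ltNge => ->.
Qed.

Theorem robust_equilibrium_exists :
  exists p : 'I_N -> PM R X, strategically_robust_equilibrium R N X A u S p.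
Proof.
have [x Kx xP] := fan; exists x; split=> [i|i p pA]; first exact: Kx.
have xA := Kx i.
have [_ _ _ ->] := valueP i p x pA Kx.
have [_ _ _ ->] := valueP i (x i) x xA Kx.
rewrite lee_fin -subr_le0.
(* Only agent [i] deviates, so the other terms of [phi x y] vanish. *)
pose y : profile := fun j => if j == i then p else x j.
have Ky : K y by move=> j; rewrite /y; case: eqP => [->|_]; [exact: pA|exact: Kx].
have := xP y Ky; rewrite /phi (bigD1 i)//= big1; last first.
  by move=> j /negbTE ji; rewrite /y ji subrr.
by rewrite addr0 /y eqxx.
Qed.

End game.

(** * The two cases *)

Section distance.
Variables (R : realType) (V : normedModType R) (O : set V).

(** The distance to the complement of [O], capped at 1; the cap keeps the set nonempty when [O] is
    the whole space. *)
Let dist (x : V) : R := inf [set r | r = 1 \/ exists2 y, ~ O y & r = `|x - y|].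

Let dist_has_inf x : has_inf [set r | r = 1 \/ exists2 y, ~ O y & r = `|x - y|].
Proof. by split; [exists 1; left|exists 0 => _ [->|[y _ ->]]]. Qed.

Let dist_lipschitz x y : dist x <= dist y + `|x - y|.
Proof.
rewrite -lerBlDr; apply: lb_le_inf; first exact: (dist_has_inf y).1.
move=> _ [->|[z Oz ->]]; rewrite lerBlDr.
  rewrite (le_trans (ge_inf (dist_has_inf x).2 (or_introl erefl)))//.
  by rewrite lerDl.
rewrite (le_trans (ge_inf (dist_has_inf x).2 (or_intror (ex_intro2 _ _ z Oz erefl))))//.
by rewrite [leRHS]addrC; have := ler_normD (x - y) (y - z); rewrite addrA subrK.
Qed.

Let dist_gt0 x : open O -> O x <-> 0 < dist x.
Proof.
move=> oO; split=> [Ox|d0].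
  have /nbhs_ballP[e /= e0 eO] : nbhs x O by apply: open_nbhs_nbhs.
  apply: (@lt_le_trans _ _ (Num.min 1 e)); first by rewrite lt_min ltr01.
  apply: lb_le_inf; first exact: (dist_has_inf x).1.
  move=> _ [->|[y Oy ->]]; first by rewrite ge_min lexx.
  rewrite ge_min; apply/orP; right; rewrite leNgt; apply/negP => xy.
  by apply/Oy/eO; rewrite -ball_normE.
apply: contrapT => nOx; move: d0; rewrite ltNge => /negP; apply.
have xx : 0 = `|x - x| by rewrite subrr normr0.
exact: (ge_inf (dist_has_inf x).2 (or_intror (ex_intro2 _ _ x nOx xx))).
Qed.

Lemma normed_perfect (A : set V) : open O -> exists g : V -> R,
  {within A, continuous g} /\ forall x, A x -> 0 <= g x /\ (O x <-> 0 < g x).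
Proof.
move=> oO; exists dist; split=> [|x _]; last first.
  split; last exact: dist_gt0.
  by apply: lb_le_inf; [exact: (dist_has_inf x).1|move=> _ [->|[y _ ->]]].
apply/within_continuousP => x e _ e0.
apply: filterS (nbhsx_ballx x e e0) => y; rewrite -ball_normE /= => xy _.
apply: le_lt_trans xy; have := dist_lipschitz x y; have := dist_lipschitz y x.
by rewrite [`|y - x|]distrC /from_subspace ler_norml => ? ?; apply/andP; split; lra.
Qed.

End distance.

(** For finite [I], finitely many coordinate conditions isolate a point, so the pointwise topology
    is discrete. *)
Lemma ptws_discrete_continuous (R : realType) (I : finType) (X : discreteTopologicalType)
    (A : set {ptws I -> X}) (f : {ptws I -> X} -> R) : {within A, continuous f}.
Proof.
apply/within_continuousP => a e _ e0.
have : \forall b \near a, forall i, b i = a i.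
  apply: (@filter_forall _ I (fun i b => b i = a i) (nbhs a) (nbhs_filter a)) => i.
  exact: (@proj_continuous _ (fun=> X) i a _ (discrete_set1 (a i))).
by apply: filterS => b ba _; rewrite (_ : b = a) ?subrr ?normr0//; exact/funext.
Qed.

Theorem theorem1 (R : realType) (N : nat) :
  (* Case (A): finite action spaces (discrete topology). *)
  (forall (X : pdiscreteTopologicalType) (A : 'I_N -> set X)
      (u : 'I_N -> ('I_N -> X) -> R) (eps : R)
      (S : R -> forall i : 'I_N, ambiguity_map R N X i),
    (forall i, finite_set (A i)) ->
    (forall i, A i !=set0) ->
    0 <= eps ->
    (forall i, admissible_ambiguity R N X A i (S eps i)) ->
    exists pbar : 'I_N -> PM R X,
      strategically_robust_equilibrium R N X A u (S eps) pbar)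
  /\
  (* Case (B): compact action spaces in R^n, continuous payoffs. *)
  (forall (n : nat) (A : 'I_N -> set 'rV[R]_n)
      (u : 'I_N -> ('I_N -> 'rV[R]_n) -> R) (eps : R)
      (S : R -> forall i : 'I_N, ambiguity_map R N 'rV[R]_n i),
    (forall i, compact (A i)) ->
    (forall i, A i !=set0) ->
    (forall i, {within Aprof N 'rV[R]_n A,
                  continuous (u i : {ptws 'I_N -> 'rV[R]_n} -> R)}) ->
    0 <= eps ->
    (forall i, admissible_ambiguity R N 'rV[R]_n A i (S eps i)) ->
    exists pbar : 'I_N -> PM R 'rV[R]_n,
      strategically_robust_equilibrium R N 'rV[R]_n A u (S eps) pbar).
Proof.
split=> [X A u eps S finA A0 _ admS|n A u eps S cA A0 cu _ admS].
  apply: robust_equilibrium_exists => //.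
  - exact: discrete_hausdorff.
  - by move=> i; exact: finite_compact.
  - move=> i O _; exists (fun x => if `[< O x >] then 1 else 0); split.
      apply/within_continuousP => x e _ e0.
      apply: filterS (discrete_set1 x) => y -> _.
      by rewrite subrr normr0.
    move=> x _; split; first by case: ifP.
    by split=> [/asboolT ->|]; [exact: ltr01|case: asboolP => // _; rewrite ltxx].
  - by move=> i; exact: ptws_discrete_continuous.
apply: robust_equilibrium_exists => //.
- by move=> i O; exact: normed_perfect.
Qed.
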